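(* Let $k$ be a perfect field of positive characteristic and let $R$ be a $k$-algebra essentially of finite type. Suppose also that $R$ is equidimensional and reduced. Then $\operatorname{jac}(R)\, \mathscr C^R \subseteq \mathscr D^{(2)}(R)$, i.e. $x\varphi\in\mathscr D^{(2)}_e(R)$ for all $e\ge 0$, $x\in\operatorname{jac}(R)$ and $\varphi\in\operatorname{Hom}_R(F^e_*R,R)$. In particular, $$\operatorname{jac}(R)\, \tau\Big(R, \prod_i \mathfrak a_i^{t_i}\Big) \subseteq \tau\Big(R, \mathscr D^{(2)}(R), \prod_i \mathfrak a_i^{t_i}\Big)$$ for all formal products of ideals $\prod_i \mathfrak a_i^{t_i}$ (finitely many ideals $\mathfrak a_i\subseteq R$, real $t_i\ge 0$) such that each $\mathfrak a_i$ contains a regular element.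
   Context: Let $p=\operatorname{char} k>0$. $F^e_*R$ denotes $R$ viewed as an $R$-module via the $e$-th iterate of Frobenius: its elements are written $F^e_*r$ and $s\cdot F^e_*r = F^e_*(s^{p^e}r)$. A Cartier algebra on $R$ is $\mathscr C=\bigoplus_{e\ge 0}\mathscr C_e$ with $\mathscr C_e\subseteq \operatorname{Hom}_R(F^e_*R,R)$, $\mathscr C_0=R$, such that each $\mathscr C_e$ is closed under addition, under $\varphi\mapsto r\varphi$ and under $\varphi \mapsto \varphi(F^e_*(r\,\cdot\,))$ for $r\in R$, and such that $\varphi\in\mathscr C_e,\psi\in\mathscr C_d$ imply $\varphi\circ F^e_*\psi\in\mathscr C_{e+d}$. The full Cartier algebra is $\mathscr C^R=\bigoplus_{e\ge0}\operatorname{Hom}_R(F^e_*R,R)$. For $R$ reduced, a Cartier algebra $\mathscr C$, ideals $\mathfrak a_i$ and real $t_i\ge0$, the test ideal $\tau(R,\mathscr C,\prod_i\mathfrak a_i^{t_i})$ is the smallest ideal $J\subseteq R$ containing a regular element such that for all $e\geq 0$, all $\varphi\in\mathscr C_e$ and all $x\in\prod_i\mathfrak a_i^{\lceil t_i(p^e-1)\rceil}$ one has $\varphi(F^e_*(xJ))\subseteq J$. One writes $\tau(R,\prod_i\mathfrak a_i^{t_i})=\tau(R,\mathscr C^R,\prod_i\mathfrak a_i^{t_i})$. Let $\mu\colon R\otimes_kR\to R$, $x\otimes y\mapsto xy$. The second diagonal Cartier algebra $\mathscr D^{(2)}(R)$ is the Cartier algebra on $R$ whose degree $e$ part $\mathscr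 D^{(2)}_e(R)$ consists of those $\varphi\in\operatorname{Hom}_R(F^e_*R,R)$ for which there exists $\widehat\varphi\in\operatorname{Hom}_{R\otimes_kR}(F^e_*(R\otimes_kR),R\otimes_kR)$ with $\mu\circ\widehat\varphi=\varphi\circ F^e_*\mu$. $\operatorname{jac}(R)$ is the Jacobian ideal of $R$ over $k$: if $R$ is a localization of $k[x_1,\dots,x_n]/(f_1,\dots,f_m)$, equidimensional of dimension $d$, it is the ideal of $R$ generated by the $(n-d)\times(n-d)$ minors of the matrix $(\partial f_i/\partial x_j)$. *)

(* Defs.v *)
From HB Require Import structures.
From mathcomp Require Import all_boot all_order all_algebra.
From mathcomp Require Import generic_quotient.
From mathcomp Require Import boolp classical_sets reals.
From mathcomp Require Import mpoly.

Set Implicit Arguments.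
Unset Strict Implicit.
Unset Printing Implicit Defensive.

Import Order.TTheory GRing.Theory Num.Theory.
Local Open Scope ring_scope.
Local Open Scope classical_set_scope.
Local Open Scope quotient_scope.

Section Ideals.
Variable A : comNzRingType.
Implicit Types I J P Q : set A.

Definition is_ideal I :=
  [/\ I 0, (forall x y, I x -> I y -> I (x + y)) & forall a x, I x -> I (a * x)].

Definition ideal_gen (S : set A) : set A :=
  \bigcap_(I in [set I | is_ideal I /\ S `<=` I]) I.

Definition ideal_mul I J : set A :=
  ideal_gen [set z | exists x y, [/\ I x, J y & z = x * y]].

Definition ideal_exp I (n : nat) : set A := iter n (ideal_mul I) setT.

Definition prime_ideal P :=
  [/\ is_ideal P, ~ P 1 & forall x y, P (x * y) -> P x \/ P y].

Definition minimal_prime P :=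
  prime_ideal P /\ forall Q, prime_ideal Q -> Q `<=` P -> Q = P.

(* A chain of n.+1 primes of A / I, seen as primes of A containing I. *)
Definition prime_chain I (n : nat) :=
  exists c : nat -> set A,
    (forall i, (i <= n)%N -> prime_ideal (c i) /\ I `<=` c i) /\
    (forall i, (i < n)%N -> c i `<` c i.+1).

(* The Krull dimension of A / I is d. *)
Definition quotient_dim I (d : nat) := prime_chain I d /\ ~ prime_chain I d.+1.

Definition equidimensional :=
  exists d, forall P, minimal_prime P -> quotient_dim P d.

Definition reduced := forall (x : A) n, x ^+ n = 0 -> x = 0.

Definition has_regular I := exists2 x, I x & GRing.lreg x.

End Ideals.

Arguments equidimensional : clear implicits.
Arguments reduced : clear implicits.

Definition perfect_field (k : fieldType) (p : nat) :=
  forall x : k, exists y, y ^+ p = x.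

(* A presentation of a k-algebra R essentially of finite type as a localization
   of k[x_1..x_n]/(f_1..f_m): the map eft_ev : k[x_1..x_n] -> R, x_j |-> v_j,
   induces an isomorphism from the localization of k[x_1..x_n]/(f_1..f_m) at the
   image of the multiplicative set eft_S onto R. *)
Record eft_presentation (k : fieldType) (R : comAlgType k) := EftPresentation {
  eft_n : nat;
  eft_m : nat;
  eft_f : 'I_eft_m -> {mpoly k[eft_n]};
  eft_S : set {mpoly k[eft_n]};
  eft_v : 'I_eft_n -> R;
  eft_ev := mmap (GRing.in_alg R) eft_v;
  eft_S1 : eft_S 1;
  eft_SM : forall s t, eft_S s -> eft_S t -> eft_S (s * t);
  eft_unit : forall s, eft_S s -> exists r, r * eft_ev s = 1;
  eft_surj : forall r, exists q s, eft_S s /\ r * eft_ev s = eft_ev q;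
  eft_ker : forall q, eft_ev q = 0 <->
              exists2 s, eft_S s & ideal_gen (range eft_f) (s * q)
}.

Section Jacobian.
Variables (k : fieldType) (R : comAlgType k) (X : eft_presentation R).

(* Every irreducible component of Spec k[x]/(f) that meets Spec R has dimension
   d; this holds in particular if k[x]/(f) is equidimensional of dimension d.
   The Krull dimension of R itself may be smaller than d: R = k(x), as a
   localization of k[x], has d = 1 and jacobian ideal R. *)
Definition eft_equidimensional (d : nat) :=
  forall P : set R, minimal_prime P -> quotient_dim (@eft_ev k R X @^-1` P) d.

Definition jacobian_matrix : 'M[{mpoly k[eft_n X]}]_(eft_m X, eft_n X) :=
  \matrix_(i, j) (eft_f i)^`M(j).

(* The indices g and h need not be increasing: repeated ones give a zero minor,
   permuted ones the same minor up to sign. *)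
Definition jac (d : nat) : set R :=
  ideal_gen [set x | exists (g : 'I_(eft_n X - d) -> 'I_(eft_m X))
                            (h : 'I_(eft_n X - d) -> 'I_(eft_n X)),
                       x = @eft_ev k R X (\det (mxsub g h jacobian_matrix))].

End Jacobian.

(* F^e_* A; s : A acts as multiplication by s ^+ (p ^ e) *)
Definition frob (A : comNzRingType) (p : nat) (hp : p \in [pchar A]) (e : nat)
  : Type := A.

Section FrobeniusPushforward.
Variables (A : comNzRingType) (p : nat) (hp : p \in [pchar A]) (e : nat).

HB.instance Definition _ := GRing.Zmodule.copy (frob hp e) A.

Definition frob_scale (s : A) (r : frob hp e) : frob hp e :=
  s ^+ (p ^ e) * (r : A).

Fact frob_scaleA a b v : frob_scale a (frob_scale b v) = frob_scale (a * b) v.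
Proof. by rewrite /frob_scale exprMn mulrA. Qed.

Fact frob_scale1 : left_id 1 frob_scale.
Proof. by move=> v; rewrite /frob_scale expr1n mul1r. Qed.

Fact frob_scaleDr : right_distributive frob_scale +%R.
Proof. by move=> a u v; exact: mulrDr. Qed.

Fact frob_scaleDl v : {morph frob_scale^~ v : a b / a + b}.
Proof.
move=> a b; rewrite /frob_scale exprDn_pchar ?mulrDl//.
by rewrite pnatX (eq_pnat _ (pcharf_eq hp)) pnat_id ?(pcharf_prime hp).
Qed.

HB.instance Definition _ := GRing.Zmodule_isLmodule.Build A (frob hp e)
  frob_scaleA frob_scale1 frob_scaleDr frob_scaleDl.

(* Hom_A(F^e_* A, A) *)
Definition homF := {linear frob hp e -> A^o}.

End FrobeniusPushforward.

Section HomOperations.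
Variables (A : comNzRingType) (p : nat) (hp : p \in [pchar A]).

(* phi(F^e_*(r . )) *)
Section Premul.
Variables (e : nat) (phi : homF hp e) (r : A).
Definition homF_premul (x : frob hp e) : A^o := phi (r * (x : A)).
Fact homF_premul_linear : linear homF_premul.
Proof.
move=> a x y; rewrite -linearP /homF_premul; congr (phi _).
by rewrite mulrDr; congr (_ + _); exact: mulrCA.
Qed.
HB.instance Definition _ :=
  GRing.isLinear.Build A (frob hp e) A^o *:%R homF_premul homF_premul_linear.
End Premul.

(* phi o F^e_* psi *)
Section Comp.
Variables (e d : nat) (phi : homF hp e) (psi : homF hp d).
Definition homF_comp (x : frob hp (e + d)) : A^o := phi (psi x).
Fact homF_comp_linear : linear homF_comp.
Proof.
move=> a x y; rewrite /homF_comp -linearP; congr (phi _).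
rewrite -[RHS]/(a ^+ (p ^ e) *: psi x + psi y) -linearP; congr (psi _).
by congr (_ + _); rewrite /GRing.scale /= /frob_scale -exprM -expnD.
Qed.
HB.instance Definition _ :=
  GRing.isLinear.Build A (frob hp (e + d)) A^o *:%R homF_comp homF_comp_linear.
End Comp.

Section Degree0.
Variable r : A.
Definition homF_of_scalar (x : frob hp 0) : A^o := r * (x : A).
Fact homF_of_scalar_linear : linear homF_of_scalar.
Proof.
move=> a x y; rewrite /homF_of_scalar mulrDr; congr (_ + _).
rewrite /GRing.scale /= /frob_scale expn0 expr1; exact: mulrCA.
Qed.
HB.instance Definition _ :=
  GRing.isLinear.Build A (frob hp 0) A^o *:%R homF_of_scalar homF_of_scalar_linear.
End Degree0.

End HomOperations.

Record cartier_algebra (A : comNzRingType) (p : nat) (hp : p \in [pchar A]) :=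
  CartierAlgebra {
  cartier_deg : forall e, set (homF hp e);
  (* Hom_A(F^0_* A, A) = A *)
  cartier_deg0 : @cartier_deg 0%N = setT;
  cartier_zero : forall e, cartier_deg (\0 : homF hp e);
  cartier_add : forall e (phi psi : homF hp e),
    cartier_deg phi -> cartier_deg psi ->
    cartier_deg (phi \+ psi : homF hp e);
  cartier_mul : forall e (r : A) (phi : homF hp e),
    cartier_deg phi -> cartier_deg (r \*: phi : homF hp e);
  cartier_premul : forall e (r : A) (phi : homF hp e),
    cartier_deg phi -> cartier_deg (homF_premul phi r : homF hp e);
  cartier_comp : forall e d (phi : homF hp e) (psi : homF hp d),
    cartier_deg phi -> cartier_deg psi ->
    cartier_deg (homF_comp phi psi : homF hp (e + d))
}.
Arguments cartier_deg {A p hp} c e _.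

Definition full_cartier (A : comNzRingType) (p : nat) (hp : p \in [pchar A]) :
  cartier_algebra hp.
Proof. by exists (fun e => setT). Defined.

Section TestIdeal.
Variables (A : comNzRingType) (p : nat) (hp : p \in [pchar A]).
Variables (K : realType) (r : nat) (a : 'I_r -> set A) (t : 'I_r -> K).

(* prod_i a_i^(ceil (t_i (p^e - 1))), for nonnegative t_i *)
Definition weight_ideal (e : nat) : set A :=
  \big[@ideal_mul A/setT]_(i < r)
     ideal_exp (a i) `|Num.ceil (t i * (p ^ e - 1)%N%:R)|%N.

Definition test_compatible (C : cartier_algebra hp) (J : set A) :=
  [/\ is_ideal J, has_regular J
    & forall e (phi : homF hp e) x y,
        cartier_deg C e phi -> weight_ideal e x -> J y -> J (phi (x * y))].

(* The smallest ideal J with test_compatible C J; see test_idealE. *)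
Definition test_ideal (C : cartier_algebra hp) : set A :=
  \bigcap_(J in test_compatible C) J.

Lemma test_idealE C tau :
  test_compatible C tau -> (forall J, test_compatible C J -> tau `<=` J) ->
  test_ideal C = tau.
Proof.
move=> ctau mtau; apply/seteqP; split=> [x|x taux J cJ]; first exact.
exact: mtau taux.
Qed.

End TestIdeal.

(* Formal sums of pure tensors x (x) y are lists of pairs (x, y); two of them are
   identified when all k-bilinear maps on R x R agree on them. *)
Section TensorSquare.
Variables (k : fieldType) (R : comAlgType k).

Definition is_bilinear (M : lmodType k) (f : R -> R -> M) :=
  (forall y, linear (f^~ y)) /\ (forall x, linear (f x)).

Definition tsum (M : lmodType k) (f : R -> R -> M) (s : seq (R * R)) : M :=
  \sum_(u <- s) f u.1 u.2.

Definition teqv (s s' : seq (R * R)) :=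
  forall (M : lmodType k) (f : R -> R -> M), is_bilinear f -> tsum f s = tsum f s'.

Definition teqvb : rel (seq (R * R)) := fun s s' => `[< teqv s s' >].

Fact teqvb_equiv : equiv_class_of teqvb.
Proof.
split=> [s|s s'|s s' s''].
- by apply/asboolP.
- by apply/asboolP/asboolP => h M f bf; rewrite h.
- by move=> /asboolP h /asboolP h'; apply/asboolP => M f bf; rewrite h ?h'.
Qed.

Canonical teqv_equiv := EquivRelPack teqvb_equiv.

Definition tensor2 := {eq_quot teqvb}.
HB.instance Definition _ := Choice.on tensor2.

Implicit Types s : seq (R * R).

Definition tclass s : tensor2 := \pi_tensor2 s.

Lemma tclassP s s' : tclass s = tclass s' <-> teqv s s'.
Proof. by split=> [/eqmodP/asboolP|h] //; apply/eqmodP/asboolP. Qed.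

Lemma tclass_repr (z : tensor2) : tclass (repr z) = z.
Proof. exact: reprK. Qed.

Lemma tensor2W (P : tensor2 -> Prop) : (forall s, P (tclass s)) -> forall z, P z.
Proof. by move=> h z; rewrite -(tclass_repr z). Qed.

Definition opp_formal s : seq (R * R) := [seq (- u.1, u.2) | u <- s].
Definition mul_formal s s' : seq (R * R) :=
  [seq (u.1 * v.1, u.2 * v.2) | u <- s, v <- s'].

Definition tpure (x y : R) : tensor2 := tclass [:: (x, y)].
Definition tzero : tensor2 := tclass [::].
Definition topp (z : tensor2) : tensor2 := tclass (opp_formal (repr z)).
Definition tadd (z w : tensor2) : tensor2 := tclass (repr z ++ repr w).
Definition tone : tensor2 := tpure 1 1.
Definition tmul (z w : tensor2) : tensor2 := tclass (mul_formal (repr z) (repr w)).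

Section Sums.
Variables (M : lmodType k) (f : R -> R -> M) (bf : is_bilinear f).

Lemma tsum_repr s : tsum f (repr (tclass s)) = tsum f s.
Proof. by have /tclassP := tclass_repr (tclass s); apply. Qed.

Lemma tsum_cat s s' : tsum f (s ++ s') = tsum f s + tsum f s'.
Proof. exact: big_cat. Qed.

Lemma bilinDl y x x' : f (x + x') y = f x y + f x' y.
Proof. by have := bf.1 y 1 x x'; rewrite !scale1r. Qed.

Lemma bilinDr x y y' : f x (y + y') = f x y + f x y'.
Proof. by have := bf.2 x 1 y y'; rewrite !scale1r. Qed.

Lemma bilin0l y : f 0 y = 0.
Proof. by apply: (addrI (f 0 y)); rewrite -bilinDl !addr0. Qed.

Lemma bilinNl x y : f (- x) y = - f x y.
Proof. by apply: (addrI (f x y)); rewrite -bilinDl !subrr bilin0l. Qed.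

Lemma tsum_opp s : tsum f (opp_formal s) = - tsum f s.
Proof.
by rewrite /tsum big_map -sumrN; apply: eq_bigr => u _; exact: bilinNl.
Qed.

Lemma tsum_mul s s' :
  tsum f (mul_formal s s') = tsum (fun x y => tsum (fun x' y' => f (x * x') (y * y')) s') s.
Proof. by rewrite /tsum big_allpairs_dep. Qed.

Lemma tsum_mulC s s' : tsum f (mul_formal s s') = tsum f (mul_formal s' s).
Proof.
rewrite !tsum_mul /tsum exchange_big; apply: eq_bigr => u _.
by apply: eq_bigr => v _; rewrite (mulrC u.1) (mulrC u.2).
Qed.

Lemma bilin_mul s' :
  is_bilinear (fun x y => tsum (fun x' y' => f (x * x') (y * y')) s').
Proof.
split=> x a u v; rewrite /tsum scaler_sumr -big_split; apply: eq_bigr => w _ /=.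
- by rewrite mulrDl -scalerAl (bf.1 _).
- by rewrite mulrDl -scalerAl (bf.2 _).
Qed.

End Sums.

Lemma tadd_class s s' : tadd (tclass s) (tclass s') = tclass (s ++ s').
Proof. by apply/tclassP => M f bf; rewrite !tsum_cat !tsum_repr. Qed.

Lemma topp_class s : topp (tclass s) = tclass (opp_formal s).
Proof. by apply/tclassP => M f bf; rewrite !tsum_opp ?tsum_repr. Qed.

Lemma tmul_class s s' : tmul (tclass s) (tclass s') = tclass (mul_formal s s').
Proof.
apply/tclassP => M f bf; rewrite tsum_mul tsum_repr; last exact: bilin_mul.
by rewrite -tsum_mul tsum_mulC tsum_mul tsum_repr; [rewrite -tsum_mul tsum_mulC|exact: bilin_mul].
Qed.

Fact taddA : associative tadd.
Proof.
by elim/tensor2W=> x; elim/tensor2W=> y; elim/tensor2W=> z; rewrite !tadd_class catA.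
Qed.

Fact taddC : commutative tadd.
Proof.
elim/tensor2W=> x; elim/tensor2W=> y; rewrite !tadd_class.
by apply/tclassP => M f bf; rewrite !tsum_cat addrC.
Qed.

Fact tadd0 : left_id tzero tadd.
Proof. by elim/tensor2W=> x; rewrite tadd_class. Qed.

Fact taddN : left_inverse tzero topp tadd.
Proof.
elim/tensor2W=> x; rewrite topp_class tadd_class.
by apply/tclassP => M f bf; rewrite tsum_cat tsum_opp// addNr /tsum big_nil.
Qed.

HB.instance Definition _ := GRing.isZmodule.Build tensor2 taddA taddC tadd0 taddN.

Fact tmulA : associative tmul.
Proof.
elim/tensor2W=> x; elim/tensor2W=> y; elim/tensor2W=> z; rewrite !tmul_class.
apply/tclassP => M f bf; rewrite !tsum_mul; apply: eq_bigr => u _.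
rewrite tsum_mul; apply: eq_bigr => v _; apply: eq_bigr => w _.
by rewrite !mulrA.
Qed.

Fact tmulC : commutative tmul.
Proof.
elim/tensor2W=> x; elim/tensor2W=> y; rewrite !tmul_class.
by apply/tclassP => M f bf; rewrite tsum_mulC.
Qed.

Fact tmul1 : left_id tone tmul.
Proof.
elim/tensor2W=> x; rewrite tmul_class; apply/tclassP => M f bf.
by rewrite tsum_mul /tsum big_seq1; apply: eq_bigr => u _; rewrite !mul1r.
Qed.

Fact tmulD : left_distributive tmul tadd.
Proof.
elim/tensor2W=> x; elim/tensor2W=> y; elim/tensor2W=> z.
rewrite !(tmul_class, tadd_class); apply/tclassP => M f bf.
by rewrite tsum_cat !tsum_mul tsum_cat.
Qed.

Lemma bilin_mulr : @is_bilinear R (fun x y => x * y).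
Proof.
by split=> x a u v; rewrite ?mulrDl ?mulrDr -?scalerAl -?scalerAr.
Qed.

Fact tone_neq0 : tone != 0.
Proof.
apply/eqP => /tclassP /(_ _ _ bilin_mulr).
by rewrite /tsum big_seq1 big_nil /= mulr1; apply/eqP; exact: oner_neq0.
Qed.

HB.instance Definition _ :=
  GRing.Zmodule_isComNzRing.Build tensor2 tmulA tmulC tmul1 tmulD tone_neq0.

(* mu : R (x) R -> R, x (x) y |-> xy *)
Definition tmu (z : tensor2) : R := tsum (fun x y => x * y) (repr z).

Lemma tmu_class s : tmu (tclass s) = \sum_(u <- s) u.1 * u.2.
Proof. exact/tsum_repr/bilin_mulr. Qed.

Lemma tmu_pure x y : tmu (tpure x y) = x * y.
Proof. by rewrite tmu_class big_seq1. Qed.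

Lemma tmuD z w : tmu (z + w) = tmu z + tmu w.
Proof.
elim/tensor2W: z => x; elim/tensor2W: w => y.
by rewrite [_ + _]tadd_class !tmu_class big_cat.
Qed.

Lemma tmuM z w : tmu (z * w) = tmu z * tmu w.
Proof.
elim/tensor2W: z => x; elim/tensor2W: w => y.
rewrite [_ * _]tmul_class !tmu_class big_allpairs_dep big_distrl.
apply: eq_bigr => u _; rewrite big_distrr.
by apply: eq_bigr => v _; rewrite mulrACA.
Qed.

Lemma tpureDl x x' y : tpure (x + x') y = tpure x y + tpure x' y.
Proof.
rewrite [RHS]tadd_class; apply/tclassP => M f bf.
by rewrite /tsum big_seq1 big_cons big_seq1 /= (bilinDl bf).
Qed.

Lemma pchar_base p : p \in [pchar k] -> p \in [pchar R].
Proof.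
rewrite !inE => /andP[-> /eqP pk]; apply/eqP.
by rewrite -(rmorph_nat (GRing.in_alg R)) pk rmorph0.
Qed.

Lemma pchar_tensor2 p : p \in [pchar R] -> p \in [pchar tensor2].
Proof.
rewrite !inE => /andP[-> /eqP pR]; apply/eqP.
have h n : (n%:R : tensor2) = tpure n%:R 1.
  elim: n => [|n IHn]; last by rewrite -natr1 IHn -[in RHS]natr1 tpureDl.
  apply/tclassP => M f bf; rewrite /tsum big_nil big_seq1 /=.
  by rewrite (bilin0l bf).
rewrite h pR; apply/tclassP => M f bf.
by rewrite /tsum big_nil big_seq1 (bilin0l bf).
Qed.

End TensorSquare.

Section SecondDiagonal.
Variables (k : fieldType) (R : comAlgType k) (p : nat) (hp : p \in [pchar R]).

Definition diag2_deg (e : nat) : set (homF hp e) :=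
  [set phi | exists hphi : homF (pchar_tensor2 hp) e,
               forall z : tensor2 R, tmu (hphi z) = phi (tmu z)].

Lemma tmu0 : tmu (0 : tensor2 R) = 0.
Proof. by rewrite [0]/(tclass _) tmu_class big_nil. Qed.

Definition diag2 : cartier_algebra hp.
Proof.
exists diag2_deg.
- apply/seteqP; split=> // phi _.
  exists (homF_of_scalar (tpure (phi 1) 1) : homF (pchar_tensor2 hp) 0) => z.
  rewrite [LHS]tmuM tmu_pure mulr1 mulrC.
  rewrite -[LHS]/(tmu z *: (phi 1 : R^o)) -linearZ; congr (phi _).
  by rewrite /GRing.scale /= /frob_scale expn0 expr1 mulr1.
- by move=> e; exists (\0 : homF _ e) => z; rewrite tmu0.
- move=> e phi psi [f hf] [g hg]; exists (f \+ g : homF _ e) => z.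
  by rewrite [LHS]tmuD hf hg.
- move=> e r phi [f hf]; exists (tpure r 1 \*: f : homF _ e) => z.
  by rewrite [LHS]tmuM hf tmu_pure mulr1.
- move=> e r phi [f hf]; exists (homF_premul f (tpure r 1) : homF (pchar_tensor2 hp) e) => z.
  by rewrite hf tmuM tmu_pure mulr1.
- move=> e d phi psi [f hf] [g hg].
  by exists (homF_comp f g : homF _ (e + d)) => z; rewrite hf hg.
Defined.

End SecondDiagonal.

(* Main.v *)
Require Import Defs.
From HB Require Import structures.
From mathcomp Require Import all_boot all_order all_algebra.
From mathcomp Require Import boolp classical_sets reals.
From mathcomp Require Import mpoly.

Set Implicit Arguments.
Unset Strict Implicit.
Unset Printing Implicit Defensive.

Import Order.TTheory GRing.Theory Num.Theory.
Local Open Scope ring_scope.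
Local Open Scope classical_set_scope.

(** Write q = p^e, and let ev : k[x_1..x_n] -> R be the presentation, d the
    dimension of the components, delta a Jacobian minor formed from relations
    f_1, .., f_(n-d) and columns h, and phi in Hom(F^e_* R, R).  A lift of
    delta phi to R (x) R is given by

      a (x) b |-> (phi (x) t) ((delta (x) 1) Y (a (x) b)),

    where Y is the product of the (1 (x) x_j - x_j (x) 1)^(q-1) over the
    variables outside the minor, and t in Hom(F^e_* R, R) is induced by
    T (F . ) on k[x]; here F is the product of the f_i^(q-1) and T is the
    generator of Hom(F^e_* k[x], k[x]), the map reading off the coefficient of
    x^(q-1) with respect to the monomial basis of F^e_* k[x].

    Why it lifts delta phi.  R (x) k[x] is the polynomial ring R[X], with
    X_j = 1 (x) x_j - x_j (x) 1 (the map taylor).  The R-linear form topcoef,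
    the coefficient of the product of all X_j^(q-1), kills the multiples of
    X_j^q, and it computes the q-th power of T on k[x].  So it suffices that
    topcoef (F Y w) = delta^(q-1) w(0) for w in R[X] (topcoef_jacobian).  Modulo
    the X_j^q and the variables in Y, each f_i is a linear form in the X_(h j)
    whose coefficients lift the entries of the minor, and a product of
    (q-1)-st powers of linear forms equals, modulo q-th powers of the
    variables, the (q-1)-st power of the determinant times the product of the
    (q-1)-st powers of the variables (det_power_mod).

    Why t exists.  One needs T (F b) to vanish in R when b does
    (topcoef_relation).  R being reduced, this can be tested at its minimal
    primes (reduced_minimal_prime).  Let P be the preimage of one in k[x]; as
    k[x]/P has dimension d, the ideal P is generated locally at P by n - d
    elements w_j (prime_locally_generated).  All f_i and b are combinations of
    the w_j, so F b has order (n-d)(q-1) + 1 in them and lies in the ideal of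
    the w_j^q, which T sends into P.  Local generation is proved by
    pseudo-division along a tower k[Y][z_1]..[z_m], where Y is a maximal set of
    variables that is algebraically independent modulo P; the same division
    shows that Y has at least as many elements as a chain of primes above P
    has strict inclusions.

    For the test ideals, let J be compatible with the diagonal algebra and c
    a regular element of J.  The ideal generated by the phi(y c), with phi
    arbitrary and y in the weight ideal, is compatible with the full algebra,
    and the Jacobian ideal multiplies it into J (full_compatible_below). *)

(** * Ideals and primes *)

Section IdealTheory.
Variable A : comNzRingType.
Implicit Types (I : set A) (x y : A).

Lemma ideal0 I : is_ideal I -> I 0. Proof. by case. Qed.

Lemma idealD I x y : is_ideal I -> I x -> I y -> I (x + y).
Proof. by case=> _ + _; apply. Qed.

Lemma idealMl I a x : is_ideal I -> I x -> I (a * x).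
Proof. by case=> _ _; apply. Qed.

Lemma idealMr I a x : is_ideal I -> I x -> I (x * a).
Proof. by rewrite mulrC; apply: idealMl. Qed.

Lemma idealN I x : is_ideal I -> I x -> I (- x).
Proof. by move=> hI Ix; rewrite -mulN1r; apply: idealMl. Qed.

Lemma idealB I x y : is_ideal I -> I x -> I y -> I (x - y).
Proof. by move=> hI Ix Iy; apply: idealD => //; apply: idealN. Qed.

Lemma ideal_sum I (T : Type) (r : seq T) (Q : pred T) (F : T -> A) :
  is_ideal I -> (forall i, Q i -> I (F i)) -> I (\sum_(i <- r | Q i) F i).
Proof.
by move=> hI h; elim/big_ind: _ => //; [case: hI | move=> x y; apply: idealD].
Qed.

Lemma ideal_sub_r I x y : is_ideal I -> I (x - y) -> I y -> I x.
Proof. by move=> hI h Iy; rewrite -(subrK y x); apply: idealD. Qed.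

Lemma ideal_gen_sub (S : set A) : S `<=` ideal_gen S.
Proof. by move=> x Sx I [_ SI]; apply: SI. Qed.

Lemma ideal_gen_min (S : set A) I : is_ideal I -> S `<=` I -> ideal_gen S `<=` I.
Proof. by move=> hI SI x; apply. Qed.

Lemma ideal_gen_ideal (S : set A) : is_ideal (ideal_gen S).
Proof.
split=> [I [hI _] | x y hx hy I hI | a x hx I hI]; first by case: hI.
- by apply: idealD; [case: hI | apply: hx | apply: hy].
- by apply: idealMl; [case: hI | apply: hx].
Qed.

Lemma prime_prod (P : set A) (T : Type) (r : seq T) (Q : pred T) (F : T -> A) :
  prime_ideal P -> (forall i, Q i -> ~ P (F i)) -> ~ P (\prod_(i <- r | Q i) F i).
Proof.
move=> [_ P1 hP] h; elim/big_ind: _ => // x y Px Py /hP[]; [exact: Px|exact: Py].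
Qed.

Lemma prime_exp (P : set A) x n : prime_ideal P -> ~ P x -> ~ P (x ^+ n).
Proof.
by move=> hP Px; rewrite -(card_ord n) -prodr_const; apply: prime_prod.
Qed.

Lemma prime_mulK (P : set A) x y : prime_ideal P -> ~ P x -> P (x * y) -> P y.
Proof. by move=> [_ _ hP] Px /hP[]. Qed.

End IdealTheory.

(** In a reduced ring the minimal primes intersect in zero: a maximal
    multiplicative set that contains x and avoids 0 has a minimal prime as its
    complement. *)
Lemma reduced_minimal_prime (A : comNzRingType) (x : A) :
  reduced A -> x <> 0 -> exists P, minimal_prime P /\ ~ P x.
Proof.
move=> red x0.
pose mult (M : set A) := [/\ M 1, M x, (forall a b, M a -> M b -> M (a * b)) & ~ M 0].
have [F hF totF|M [hM maxM]] :=
    @Zorn_bigcup A [set M | M = set0 \/ mult M] _.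
  have [[M FM Mx]|nM] := pselect (exists2 M, F M & M x); last first.
    left; apply/eqP; apply: contra_notT nM => /set0P[a [M FM Ma]].
    by exists M => //; case: (hF M FM) => [M0|[]//]; rewrite M0 in Ma.
  have multF N a : F N -> N a -> mult N.
    by move=> FN Na; case: (hF N FN) => // N0; rewrite N0 in Na.
  right; split.
  - by exists M => //; case: (multF M x).
  - by exists M.
  - move=> a b [Na FNa Naa] [Nb FNb Nbb].
    have [sub|sub] := totF Na Nb FNa FNb.
    + by exists Nb => //; case: (multF _ _ FNb Nbb) => _ _ h _; apply: h => //; apply: sub.
    + by exists Na => //; case: (multF _ _ FNa Naa) => _ _ h _; apply: h => //; apply: sub.
  - by case=> N FN N0; case: (multF _ _ FN N0).
have {hM} [M1 Mx MM M0] : mult M.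
  case: hM => // M0; exfalso; rewrite {M}M0 in maxM.
  apply: (maxM [set x ^+ n | n in setT]).
    by rewrite properEneq; split=> //; apply/eqP => e; suff: (set0 : set A) 1 by []; rewrite e; exists 0%N; rewrite ?expr0.
  right; split; first by exists 0%N.
  - by exists 1%N.
  - by move=> _ _ [m _ <-] [n _ <-]; exists (m + n)%N; rewrite ?exprD.
  - by case=> n _ /red.
have maxM' (a : A) : ~ M a -> exists m n, M m /\ m * a ^+ n = 0.
  move=> Ma; apply: contrapT => hn.
  apply: (maxM [set b | exists m n, M m /\ b = m * a ^+ n]).
    split; first by move=> m Mm; exists m, 0%N; rewrite mulr1.
    by move=> sub; apply: Ma; apply: sub; exists 1, 1%N; rewrite mul1r.
  right; split; [by exists 1, 0%N; rewrite mulr1|by exists x, 0%N; rewrite mulr1| |].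
  - move=> _ _ [m [i [Mm ->]]] [n [j [Mn ->]]]; exists (m * n), (i + j)%N.
    by rewrite exprD mulrACA; split=> //; apply: MM.
  - by case=> m [n [Mm e]]; apply: hn; exists m, n.
have primeM : prime_ideal (~` M).
  split; last 2 first.
  - exact.
  - move=> a b Mab; have [Ma|] := pselect (M a); last by left.
    by right=> Mb; apply: Mab; apply: MM.
  split=> // [a b|a b].
  - move=> /maxM'[m [i [Mm mi]]] /maxM'[n [j [Mn nj]]] Mab; apply: M0.
    have -> : 0 = m * n * (a + b) ^+ (i + j); last first.
      apply: (MM); first exact: MM.
      by elim: (i + j)%N => // l IH; rewrite exprS; apply: MM.
    rewrite exprDn mulr_sumr big1 // => l _; rewrite mulrnAr.
    case: (leqP j l) => jl.
      rewrite -(subnK jl) (exprD b) [m * n]mulrC [_ * b ^+ j]mulrC.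
      by rewrite [X in _ * X]mulrCA mulrACA nj mul0r mul0rn.
    have il : (i <= i + j - l)%N by rewrite -addnBA ?leq_addr // ltnW.
    rewrite -(subnK il) (exprD a) [_ * a ^+ i]mulrC -[X in _ * X]mulrA.
    by rewrite mulrACA mi mul0r mul0rn.
  - move=> /maxM'[m [n [Mm mn]]] Mab; apply: M0.
    have -> : 0 = m * (a * b) ^+ n by rewrite exprMn mulrCA mn mulr0.
    by apply: (MM) => //; elim: n {mn} => // l IH; rewrite exprS; apply: MM.
exists (~` M); split; last exact.
split=> // Q [hQ Q1 Qp] sub; apply: contrapT => neq.
apply: (maxM (~` Q)).
  rewrite properEneq; split; last by move=> a Ma Qa; apply: sub Ma.
  by apply/eqP => e; apply: neq; rewrite e setCK.
right; split=> //; first by move=> /sub.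
- by move=> a b Qa Qb /Qp[].
- by apply; case: hQ.
Qed.

(** * Pseudo-division and prime ideals along a tower of subrings *)

Section Adjoin.
Variable A : comNzRingType.
Implicit Types (B P Q : set A) (z : A) (w q : {poly A}).

Definition subring B :=
  [/\ B 1, forall x y, B x -> B y -> B (x - y) & forall x y, B x -> B y -> B (x * y)].

Definition coefs_in B w := forall i, B w`_i.

Lemma size_sub_lead w : w != 0 ->
  (size (w - (lead_coef w)%:P * 'X^((size w).-1))%R < size w)%N.
Proof.
rewrite -size_poly_gt0 => wgt0.
rewrite -[X in (_ < X)%N](prednK wgt0) ltnS; apply/leq_sizeP => j hj.
rewrite coefB mul_polyC coefZ coefXn.
have [->|nej] := eqVneq; first by rewrite mulr1 subrr.
by rewrite nth_default ?mulr0 ?subrr // -(prednK wgt0) ltn_neqAle eq_sym nej.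
Qed.

Definition adjoin B z : set A := [set g | exists2 q, coefs_in B q & g = q.[z]].

Section Subring.
Variable B : set A.
Hypothesis sB : subring B.

Lemma subring0 : B 0.
Proof. by case: sB => B1 BB _; rewrite -(subrr 1); apply: BB. Qed.

Lemma subringN x : B x -> B (- x).
Proof. by case: sB => _ BB _ Bx; rewrite -sub0r; apply: BB => //; apply: subring0. Qed.

Lemma subringD x y : B x -> B y -> B (x + y).
Proof. by case: sB => _ BB _ Bx By; rewrite -(opprK y); apply: BB => //; apply: subringN. Qed.

Lemma subring_sum (T : Type) (r : seq T) (F : T -> A) :
  (forall i, B (F i)) -> B (\sum_(i <- r) F i).
Proof.
by move=> h; elim/big_ind: _ => //; [apply: subring0 | apply: subringD].
Qed.

Lemma coefs_inB w q : coefs_in B w -> coefs_in B q -> coefs_in B (w - q).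
Proof. by case: sB => _ BB _ hw hq i; rewrite coefB; apply: BB. Qed.

Lemma coefs_inD w q : coefs_in B w -> coefs_in B q -> coefs_in B (w + q).
Proof. by move=> hw hq i; rewrite coefD; apply: subringD. Qed.

Lemma coefs_inM w q : coefs_in B w -> coefs_in B q -> coefs_in B (w * q).
Proof.
by case: sB => _ _ BM hw hq i; rewrite coefM; apply: subring_sum => j; apply: BM.
Qed.

Lemma coefs_inC c : B c -> coefs_in B c%:P.
Proof. by move=> Bc i; rewrite coefC; case: eqP => // _; apply: subring0. Qed.

Lemma coefs_inX : coefs_in B 'X.
Proof. by case: sB => B1 _ _ i; rewrite coefX; case: eqP => // _; apply: subring0. Qed.

Lemma coefs_inXn n : coefs_in B 'X^n.
Proof. by case: sB => B1 _ _ i; rewrite coefXn; case: eqP => // _; apply: subring0. Qed.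

Lemma coefs_in_monomial c n : B c -> coefs_in B (c%:P * 'X^n).
Proof. by move=> Bc; apply: coefs_inM; [apply: coefs_inC | apply: coefs_inXn]. Qed.

Lemma adjoin_subring z : subring (adjoin B z).
Proof.
split=> [|_ _ [w hw ->] [q hq ->]|_ _ [w hw ->] [q hq ->]].
- by exists 1%:P; [apply: coefs_inC; case: sB | rewrite hornerC].
- by exists (w - q); [apply: coefs_inB | rewrite hornerD hornerN].
- by exists (w * q); [apply: coefs_inM | rewrite hornerM].
Qed.

Lemma adjoin_sub z : B `<=` adjoin B z.
Proof. by move=> c Bc; exists c%:P; [apply: coefs_inC | rewrite hornerC]. Qed.

Lemma adjoin_gen z : adjoin B z z.
Proof. by exists 'X; [apply: coefs_inX | rewrite hornerX]. Qed.

Lemma pseudo_division w q : w != 0 -> coefs_in B w -> coefs_in B q ->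
  exists N u r, [/\ (lead_coef w ^+ N)%:P * q = u * w + r, coefs_in B u,
                    coefs_in B r & (size r < size w)%N /\
                    (size u <= (size q).+1 - size w)%N].
Proof.
move=> w0 hw; have [n] := ubnP (size q); elim: n q => // n IH q szq hq.
have [B1 _ BM] := sB.
have [lt|le] := ltnP (size q) (size w).
  exists 0%N, 0, q; split=> //; last by rewrite size_poly0.
    by rewrite expr0 mul1r mul0r add0r.
  by move=> i; rewrite coef0; apply: subring0.
pose s := (lead_coef q)%:P * 'X^(size q - size w).
pose q' := (lead_coef w)%:P * q - s * w.
have hs : coefs_in B s.
  by apply: coefs_in_monomial; apply: hq.
have hq' : coefs_in B q'.
  by apply: coefs_inB; apply: coefs_inM => //; apply: coefs_inC; apply: hw.
have wgt0 : (0 < size w)%N by rewrite size_poly_gt0.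
have qgt0 : (0 < size q)%N := leq_trans wgt0 le.
have szq' : (size q' < size q)%N.
  rewrite -[X in (_ < X)%N](prednK qgt0) ltnS; apply/leq_sizeP => j hj.
  rewrite coefB mul_polyC coefZ /s -mulrA mul_polyC coefZ coefXnM.
  have -> : (j < size q - size w)%N = false.
    by apply/negbTE; rewrite -leqNgt (leq_trans _ hj) // -subn1 leq_sub2l.
  have [ej|nej] := eqVneq j (size q).-1.
    rewrite ej -lead_coefE -subn1 subnAC subKn // subn1 -lead_coefE.
    by rewrite mulrC subrr.
  have hj' : (size q <= j)%N.
    by rewrite -(prednK qgt0) ltn_neqAle eq_sym nej hj.
  rewrite nth_default // [w`_ _]nth_default ?mulr0 ?subrr //.
  by rewrite leq_subRL ?(leq_trans (leq_subr _ _)) // subnK.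
have [N [u [r [e hu hr [szr szu]]]]] := IH q' (leq_trans szq' szq) hq'.
exists N.+1, ((lead_coef w ^+ N)%:P * s + u), r; split=> //.
- rewrite exprSr polyCM -mulrA -[_ * q](subrK (s * w)) -/q' mulrDr e.
  by rewrite mulrDl [LHS]addrC -mulrA addrA.
- apply: coefs_inD => //; apply: coefs_inM => //; apply: coefs_inC.
  by elim: N {e} => // N IHN; rewrite exprS; apply: BM => //; apply: hw.
- split=> //; apply: leq_trans (size_polyD _ _) _; rewrite geq_max; apply/andP; split.
    apply: leq_trans (size_polyMleq _ _) _.
    rewrite size_polyC; apply: (@leq_trans (1 + size s)%N.-1).
      by rewrite -!subn1 leq_sub2r // leq_add2r; case: (_ != 0).
    rewrite add1n; apply: leq_trans (size_polyMleq _ _) _.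
    rewrite size_polyC size_polyXn -subSn //.
    by apply: (@leq_trans (1 + (size q - size w).+1).-1) => //; rewrite -?subSn // -!subn1 leq_sub2r // leq_add2r; case: (_ != 0).
  by apply: leq_trans szu _; rewrite leq_sub2r // ltnS ltnW.
Qed.

End Subring.

(** z is algebraic over the fraction field of B / (P cap B), in A / P. *)
Definition algebraic_mod P B z :=
  exists w, [/\ coefs_in B w, P w.[z] & exists i, ~ P w`_i].

Lemma algebraic_modS P B B' z :
  B `<=` B' -> algebraic_mod P B z -> algebraic_mod P B' z.
Proof. by move=> sub [w [hw Pw hi]]; exists w; split=> // i; apply/sub/hw. Qed.

(** A polynomial of least size among those that are nonzero modulo P and have
    value in P at z.  Its leading coefficient is not in P, as otherwise the
    leading term could be dropped. *)
Lemma minimal_poly_mod P B z : prime_ideal P -> subring B ->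
  algebraic_mod P B z ->
  exists w, [/\ coefs_in B w, P w.[z], ~ P (lead_coef w)
    & forall q, coefs_in B q -> P q.[z] -> (size q < size w)%N ->
        forall i, P q`_i].
Proof.
move=> [hP P1 _] sB [w0 hw0].
pose test n := `[< exists w, [/\ coefs_in B w, P w.[z], exists i, ~ P w`_i
                              & size w = n] >].
have ex : exists n, test n.
  by exists (size w0); apply/asboolP; exists w0; case: hw0.
case: (ex_minnP ex) => n /asboolP[w [hw Pw [i Pi] szw]] minn.
have small q : coefs_in B q -> P q.[z] -> (size q < size w)%N -> forall j, P q`_j.
  move=> hq Pq szq j; apply: contrapT => Pj.
  have /minn : test (size q) by apply/asboolP; exists q; split=> //; exists j.
  by rewrite -szw leqNgt szq.
have w_neq0 : w != 0.
  by apply/eqP => w_eq0; apply: Pi; rewrite w_eq0 coef0; apply: ideal0.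
exists w; split=> // Pl; apply: Pi.
pose q := w - (lead_coef w)%:P * 'X^((size w).-1).
have Pq : P q.[z].
  by rewrite hornerD hornerN hornerM hornerC; apply: idealB => //; apply: idealMr.
have hq : coefs_in B q.
  by apply: coefs_inB => //; apply: coefs_in_monomial => //; apply: hw.
have szq : (size q < size w)%N := size_sub_lead w_neq0.
have := small q hq Pq szq i; rewrite coefB mul_polyC coefZ => h.
by apply: ideal_sub_r h _ => //; apply: idealMr.
Qed.

Definition locally_generated P B (ws : seq A) :=
  (forall x, x \in ws -> P x) /\
  (forall g, B g -> P g -> exists2 s, ~ P s & ideal_gen [set` ws] (s * g)).

(** The minimal polynomial of z is the one new generator: dividing an element of
    P in B[z] by it leaves a remainder of smaller degree, so with all its
    coefficients in P and B. *)
Lemma locally_generated_step P B z ws : prime_ideal P -> subring B ->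
  algebraic_mod P B z -> locally_generated P B ws ->
  exists x, locally_generated P (adjoin B z) (x :: ws).
Proof.
move=> hP sB algz [wsP gen].
have [W [hW PW PlW minW]] := minimal_poly_mod hP sB algz.
have [idP _ _] := hP.
exists W.[z]; split=> [x|_ [q hq ->] Pq].
  by rewrite inE => /orP[/eqP->//|]; apply: wsP.
have W0 : W != 0.
  by apply/eqP => e; apply: PlW; rewrite e lead_coef0; apply: ideal0.
have [N [u [r [e hu hr [szr _]]]]] := pseudo_division sB W0 hW hq.
have ez : lead_coef W ^+ N * q.[z] = u.[z] * W.[z] + r.[z].
  by rewrite -hornerM -hornerD -e hornerM hornerC.
have Pr : P r.[z].
  have -> : r.[z] = lead_coef W ^+ N * q.[z] - u.[z] * W.[z].
    by rewrite ez addrAC subrr add0r.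
  by apply: idealB => //; apply: idealMl.
have /choice[s hs] : forall i : 'I_(size r), exists s,
    ~ P s /\ ideal_gen [set` ws] (s * r`_i).
  by move=> i; have [s] := gen r`_i (hr i) (minW r hr Pr szr i); exists s.
exists ((\prod_i s i) * lead_coef W ^+ N).
  have [_ _ pP] := hP; case/pP; first by apply: (prime_prod (P := P)) => // i _; case: (hs i).
  exact: prime_exp.
have idG : is_ideal (ideal_gen [set` W.[z] :: ws]) := @ideal_gen_ideal _ _.
rewrite -mulrA ez mulrDr; apply: (idealD idG).
  rewrite mulrA; apply: (idealMl _ idG).
  by apply: ideal_gen_sub; rewrite /= inE eqxx.
rewrite [r.[z]]horner_coef mulr_sumr; apply: (ideal_sum _ idG) => i _.
rewrite mulrA; apply: (idealMr _ idG); rewrite (bigD1 i) //= mulrAC.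
apply: (idealMr _ idG); have [_] := hs i; apply: ideal_gen_min => //.
by move=> x hx; apply: ideal_gen_sub; rewrite /= inE [X in _ || X]hx orbT.
Qed.

(** Incomparability for an algebraic extension: a prime Q above P that does not
    grow in B does not grow in B[z].  Modulo P and up to factors outside P, an
    element of Q outside P of least degree in z divides the minimal polynomial
    of z; by minimality it then has degree zero and lies in B. *)
Lemma prime_incomparable P Q B z : prime_ideal P -> prime_ideal Q -> P `<=` Q ->
  subring B -> algebraic_mod P B z -> Q `&` B `<=` P -> Q `&` adjoin B z `<=` P.
Proof.
move=> hP hQ PQ sB algz QB x [Qx [q0 hq0 def_x]]; rewrite def_x in Qx *.
have [W [hW PW PlW minW]] := minimal_poly_mod hP sB algz.
have [idP _ pP] := hP; have [idQ _ pQ] := hQ.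
apply: contrapT => Pq0.
pose test n := `[< exists q, [/\ coefs_in B q, Q q.[z], ~ P q.[z] & size q = n] >].
have ex : exists n, test n by exists (size q0); apply/asboolP; exists q0.
case: (ex_minnP ex) => n /asboolP[q [hq Qq Pq szq]] minn.
have small r : coefs_in B r -> Q r.[z] -> (size r < size q)%N -> P r.[z].
  move=> hr Qr szr; apply: contrapT => Pr.
  have /minn : test (size r) by apply/asboolP; exists r.
  by rewrite -szq leqNgt szr.
have W0 : W != 0.
  by apply/eqP => e; apply: PlW; rewrite e lead_coef0; apply: ideal0.
have q0' : q != 0 by apply/eqP => e; apply: Pq; rewrite e horner0; apply: ideal0.
have szqW : (size q < size W)%N.
  have [N [u [r [e hu hr [szr _]]]]] := pseudo_division sB W0 hW hq.
  have ez : lead_coef W ^+ N * q.[z] = u.[z] * W.[z] + r.[z].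
    by rewrite -hornerM -hornerD -e hornerM hornerC.
  have er : r.[z] = lead_coef W ^+ N * q.[z] - u.[z] * W.[z].
    by rewrite ez addrAC subrr add0r.
  rewrite ltnNge; apply/negP => le.
  have Pr : P r.[z].
    apply: small => //; last exact: leq_trans szr le.
    by rewrite er; apply: idealB => //; apply: idealMl => //; apply: PQ.
  apply: Pq; apply: (prime_mulK hP (prime_exp (n := N) hP PlW)).
  by rewrite ez; apply: idealD => //; apply: idealMl.
have Plq : ~ P (lead_coef q).
  move=> Pl; pose q1 := q - (lead_coef q)%:P * 'X^((size q).-1).
  have Pd : P ((lead_coef q)%:P * 'X^((size q).-1)).[z].
    by rewrite hornerM hornerC; apply: idealMr.
  apply: Pq; rewrite -(subrK ((lead_coef q)%:P * 'X^((size q).-1)) q) -/q1 hornerD.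
  apply: idealD => //; apply: small.
  - by apply: coefs_inB => //; apply: coefs_in_monomial => //; apply: hq.
  - by rewrite hornerD hornerN; apply: idealB => //; apply: PQ.
  - exact: size_sub_lead.
have Qlq : ~ Q (lead_coef q).
  by move=> Ql; apply: Plq; apply: QB; split=> //; apply: hq.
have [N [u [r [e hu hr [szr szu]]]]] := pseudo_division sB q0' hq hW.
have ez : lead_coef q ^+ N * W.[z] = u.[z] * q.[z] + r.[z].
  by rewrite -hornerM -hornerD -e hornerM hornerC.
have er : r.[z] = lead_coef q ^+ N * W.[z] - u.[z] * q.[z].
  by rewrite ez addrAC subrr add0r.
have Pr : P r.[z].
  apply: small => //; rewrite er; apply: idealB => //; apply: idealMl => //.
  exact: PQ.
have Pu : P u.[z].
  apply: (prime_mulK hP Pq); rewrite mulrC.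
  have -> : u.[z] * q.[z] = lead_coef q ^+ N * W.[z] - r.[z] by rewrite ez addrK.
  by apply: idealB => //; apply: idealMl.
have q1 : (1 < size q)%N.
  rewrite ltnNge; apply/negP => /size1_polyC eq; apply: Pq.
  rewrite eq hornerC; apply: QB; split; last exact: hq.
  by move: Qq; rewrite eq hornerC coefC eqxx.
have Pui := minW u hu Pu.
(* since q has positive degree the quotient u is shorter than W, hence vanishes
   modulo P; but then so does the leading coefficient of lc(q)^N W *)
have : P ((lead_coef q ^+ N)%:P * W)`_(size W).-1.
  rewrite e coefD coefM; apply: idealD => //.
    apply: ideal_sum => // j _; apply: idealMr => //; apply: Pui.
    apply: leq_ltn_trans szu _; rewrite ltn_subLR ?(leq_trans (ltnW szqW)) //.
    by rewrite -[X in (X < _)%N]add1n ltn_add2r.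
  rewrite [r`_ _]nth_default; first exact: ideal0.
  by rewrite -ltnS prednK ?size_poly_gt0 // (leq_trans szr) // ltnW.
rewrite mul_polyC coefZ -lead_coefE => /pP[]; last exact: PlW.
exact: prime_exp.
Qed.

End Adjoin.

(** * Primes of a polynomial ring *)

Section Tower.
Variables (k : fieldType) (n : nat).
Local Notation S := {mpoly k[n]}.
Implicit Types (B P Q : set S) (Y Z : seq 'I_n).

Definition adjoin_vars B Z : set S := foldr (fun i B' => adjoin B' 'X_i) B Z.

Definition constants : set S := range (@mpolyC n k).

Definition vars_subring Y := adjoin_vars constants Y.

Lemma constants_subring : subring constants.
Proof.
split=> [|_ _ [a _ <-] [b _ <-]|_ _ [a _ <-] [b _ <-]].
- by exists 1 => //; rewrite mpolyC1.
- by exists (a - b) => //; rewrite mpolyCB.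
- by exists (a * b) => //; rewrite mpolyCM.
Qed.

Lemma adjoin_vars_subring B Z : subring B -> subring (adjoin_vars B Z).
Proof. by move=> sB; elim: Z => //= i Z IH; apply: adjoin_subring. Qed.

Lemma adjoin_vars_sub B Z : subring B -> B `<=` adjoin_vars B Z.
Proof.
move=> sB; elim: Z => //= i Z IH; apply: subset_trans IH _.
exact/adjoin_sub/adjoin_vars_subring.
Qed.

Lemma vars_subring_subring Y : subring (vars_subring Y).
Proof. exact: adjoin_vars_subring constants_subring. Qed.

Lemma vars_subring_var Y i : i \in Y -> vars_subring Y 'X_i.
Proof.
elim: Y => //= j Y IH; rewrite inE => /orP[/eqP->|/IH iY].
  exact/adjoin_gen/vars_subring_subring.
by apply: adjoin_sub iY; apply: vars_subring_subring.
Qed.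

Lemma vars_subring_full Y : (forall i, i \in Y) -> forall g, vars_subring Y g.
Proof.
move=> hY; have sB := vars_subring_subring Y.
have [B1 _ BM] := sB.
have BX g m : vars_subring Y g -> vars_subring Y (g ^+ m).
  by move=> Bg; elim: m => // m IH; rewrite exprS; apply: BM.
move=> g; elim/mpolyind: g => [|c m g _ _ Bg]; first exact: subring0.
apply: subringD => //; rewrite -mul_mpolyC; apply: (BM).
  by apply: adjoin_vars_sub; [apply: constants_subring | exists c].
rewrite mpolyXE_id; apply: (big_ind (vars_subring Y)) => [//|g1 g2|i _]; first exact: BM.
by apply: BX; apply: vars_subring_var.
Qed.

Lemma adjoin_vars_generated P B Z : prime_ideal P -> subring B ->
  (forall g, B g -> P g -> g = 0) ->
  (forall i, i \in Z -> algebraic_mod P B 'X_i) ->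
  exists2 ws, size ws = size Z & locally_generated P (adjoin_vars B Z) ws.
Proof.
move=> hP sB PB; elim: Z => [|i Z IH] algZ.
  exists [::] => //; split=> // g Bg Pg; exists 1; first by case: hP.
  by rewrite (PB g Bg Pg) mulr0; apply: ideal0; apply: ideal_gen_ideal.
have [ws szws gen] : exists2 ws, size ws = size Z &
    locally_generated P (adjoin_vars B Z) ws.
  by apply: IH => j jZ; apply: algZ; rewrite inE jZ orbT.
have algi : algebraic_mod P (adjoin_vars B Z) 'X_i.
  apply: algebraic_modS (adjoin_vars_sub Z sB) _.
  by apply: algZ; rewrite inE eqxx.
have [w genw] := locally_generated_step hP (adjoin_vars_subring Z sB) algi gen.
by exists (w :: ws) => //=; rewrite szws.
Qed.

Lemma adjoin_vars_incomparable P Q B Z : prime_ideal P -> prime_ideal Q ->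
  P `<=` Q -> subring B -> (forall i, i \in Z -> algebraic_mod P B 'X_i) ->
  Q `&` B `<=` P -> Q `&` adjoin_vars B Z `<=` P.
Proof.
move=> hP hQ PQ sB; elim: Z => [//|i Z IH] algZ QB /=.
apply: prime_incomparable => //; first exact: adjoin_vars_subring.
  apply: algebraic_modS (adjoin_vars_sub Z sB) _.
  by apply: algZ; rewrite inE eqxx.
by apply: IH => // j jZ; apply: algZ; rewrite inE jZ orbT.
Qed.

(** Algebraic independence of the variables in Y, as elements of the quotient by
    P over k. *)
Definition independent_mod P Y := forall g, vars_subring Y g -> P g -> g = 0.

Lemma independent_mod_nil P : prime_ideal P -> independent_mod P [::].
Proof.
move=> [hP P1 _] _ [c _ <-] Pc; have [->|c0] := eqVneq c 0; first by rewrite mpolyC0.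
case: P1; have -> : 1 = (c^-1)%:MP * c%:MP :> S by rewrite -mpolyCM mulVf.
exact: idealMl.
Qed.

Lemma algebraic_of_dependent P Y i :
  independent_mod P Y -> ~ independent_mod P (i :: Y) ->
  algebraic_mod P (vars_subring Y) 'X_i.
Proof.
move=> indY; apply: contra_notP => nalg _ [q hq ->] Pq.
suff -> : q = 0 by rewrite horner0.
apply/polyP => j; rewrite coef0; apply: indY; first exact: hq.
by apply: contrapT => Pj; apply: nalg; exists q; split=> //; exists j.
Qed.

(** The transcendence degree drops along a strict inclusion of primes: if no
    variable could be added to Y modulo P, everything would be algebraic over
    k[Y] modulo P, and Q would meet k[Y]. *)
Lemma independent_extend P Q Y : prime_ideal P -> prime_ideal Q -> P `<` Q ->
  independent_mod Q Y -> exists2 i, i \notin Y & independent_mod P (i :: Y).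
Proof.
move=> hP hQ [PQ nQP] indY; apply: contrapT => nex; apply: nQP => g Qg.
pose Z := [seq i <- enum 'I_n | i \notin Y].
have indPY : independent_mod P Y by move=> h Bh Ph; apply: indY => //; apply: PQ.
have algZ i : i \in Z -> algebraic_mod P (vars_subring Y) 'X_i.
  rewrite mem_filter => /andP[iY _]; apply: algebraic_of_dependent => // ind.
  by apply: nex; exists i.
have sB := vars_subring_subring Y.
apply: (adjoin_vars_incomparable hP hQ PQ sB algZ).
  by move=> h [Qh Bh]; rewrite (indY h Bh Qh); apply: ideal0; case: hP.
split=> //; rewrite /vars_subring /adjoin_vars -foldr_cat.
apply: vars_subring_full => i; rewrite mem_cat mem_filter mem_enum andbT.
by case: (i \in Y).
Qed.

(** Going down the chain, each strict inclusion allows one more independent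
    variable. *)
Lemma chain_independent P d : prime_ideal P -> prime_chain P d ->
  exists Y, [/\ uniq Y, size Y = d & independent_mod P Y].
Proof.
move=> hP [c [hc sc]].
have [Pc0 sub0] := hc 0%N (leq0n d).
have step m : (m <= d)%N -> exists Y,
    [/\ uniq Y, size Y = m & independent_mod (c (d - m)%N) Y]; last first.
  have [Y [uY szY indY]] := step d (leqnn d).
  by exists Y; split=> // g Bg Pg; apply: indY => //; rewrite subnn; apply: sub0.
elim: m => [_|m IH md].
  by exists [::]; split=> //; apply: independent_mod_nil; case: (hc _ (leq_subr 0 d)).
have [Y [uY szY indY]] := IH (ltnW md).
have hlt : (d - m.+1 < d)%N by rewrite ltn_subrL (leq_ltn_trans (leq0n m) md).
have := sc _ hlt; rewrite -[X in _ `<` c X]subSn // subSS => lt.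
have [i iY indiY] := independent_extend (hc _ (leq_subr _ _)).1
  (hc _ (leq_subr _ _)).1 lt indY.
by exists (i :: Y); rewrite /= iY uY szY.
Qed.

Lemma ideal_gen_combination (c : nat) (ws : seq S) g : (size ws <= c)%N ->
  ideal_gen [set` ws] g -> exists a : 'I_c -> S, g = \sum_i a i * ws`_i.
Proof.
move=> szws; apply: (@ideal_gen_min _ _ [set g | exists a : 'I_c -> S, g = \sum_i a i * ws`_i]).
  split=> [|_ _ [a ->] [b ->]|h _ [a ->]].
  - by exists (fun=> 0); rewrite big1 // => i _; rewrite mul0r.
  - by exists (fun i => a i + b i); rewrite -big_split; apply: eq_bigr => i _; rewrite mulrDl.
  - by exists (fun i => h * a i); rewrite mulr_sumr; apply: eq_bigr => i _; rewrite mulrA.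
move=> w /= wws; have lt : (index w ws < c)%N.
  by apply: leq_trans szws; rewrite index_mem.
exists (fun i => (i == Ordinal lt)%:R); rewrite (bigD1 (Ordinal lt)) //= eqxx mul1r.
by rewrite nth_index // big1 ?addr0 // => i /negbTE->; rewrite mul0r.
Qed.

(** Modulo P all variables are algebraic over a maximal independent set, which
    has at least d elements; each of the at most n - d others costs one
    generator. *)
Lemma prime_locally_generated P d : prime_ideal P -> prime_chain P d ->
  exists w : 'I_(n - d) -> S, (forall i, P (w i)) /\
    forall g, P g -> exists2 s, ~ P s &
      exists a : 'I_(n - d) -> S, s * g = \sum_i a i * w i.
Proof.
move=> hP /(chain_independent hP)[Y0 [uY0 szY0 indY0]].
have [Y [uY dY indY maxY]] : exists Y, [/\ uniq Y, (d <= size Y)%N,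
    independent_mod P Y & forall i, i \notin Y -> ~ independent_mod P (i :: Y)].
  pose test m := `[< exists Y, [/\ uniq Y, size Y = m & independent_mod P Y] >].
  have ex : exists m, test m by exists d; apply/asboolP; exists Y0.
  have bd m : test m -> (m <= n)%N.
    move=> /asboolP[Y [uY <- _]]; rewrite -[n in (_ <= n)%N]card_ord -(card_uniqP uY).
    exact: max_card.
  case: (ex_maxnP ex bd) => m /asboolP[Y [uY szY indY]] maxm.
  exists Y; split=> //.
    by rewrite szY; apply: maxm; apply/asboolP; exists Y0.
  move=> i iY ind; have /maxm : test m.+1.
    by apply/asboolP; exists (i :: Y); rewrite /= iY szY.
  by rewrite ltnn.
pose Z := [seq i <- enum 'I_n | i \notin Y].
have szZ : (size Z <= n - d)%N.
  rewrite -(leq_add2l (size Y)); apply: (@leq_trans n); last first.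
    by rewrite -leq_subLR leq_sub2l.
  have uZ : uniq Z by rewrite filter_uniq // enum_uniq.
  rewrite -(card_uniqP uY) -(card_uniqP uZ) -[X in (_ <= X)%N]card_ord -(cardC (mem Y)).
  rewrite leq_add2l; apply/eq_leq/eq_card => i.
  by rewrite mem_filter mem_enum andbT.
have algZ i : i \in Z -> algebraic_mod P (vars_subring Y) 'X_i.
  by rewrite mem_filter => /andP[iY _]; apply: algebraic_of_dependent => //; apply: maxY.
have [ws szws [wsP gen]] :=
  adjoin_vars_generated hP (vars_subring_subring Y) indY algZ.
exists (fun i => ws`_i); split=> [i|g Pg].
  have [lt|le] := ltnP i (size ws); first exact/wsP/mem_nth.
  by rewrite nth_default //; apply: ideal0; case: hP.
have [|s Ps /ideal_gen_combination] := gen g _ Pg.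
  rewrite /vars_subring /adjoin_vars -foldr_cat.
  apply: vars_subring_full => i; rewrite mem_cat mem_filter mem_enum andbT.
  by case: (i \in Y).
by move=> h; exists s => //; apply: h; rewrite szws.
Qed.

End Tower.

(** * Powers of linear forms modulo Frobenius powers *)

Section IdealCongruence.
Variables (E : comNzRingType) (I : set E).
Hypothesis hI : is_ideal I.

Lemma ideal_cong_trans x y z : I (x - y) -> I (y - z) -> I (x - z).
Proof. by move=> h h'; rewrite -(subrKA y); apply: idealD. Qed.

Lemma ideal_cong_mul x y x' y' : I (x - y) -> I (x' - y') -> I (x * x' - y * y').
Proof.
move=> h h'; apply: (@ideal_cong_trans _ (y * x')).
  by rewrite -mulrBl; apply: idealMr.
by rewrite -mulrBr; apply: idealMl.
Qed.

Lemma ideal_cong_prod (T : Type) (r : seq T) (Q : pred T) (F G : T -> E) :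
  (forall i, Q i -> I (F i - G i)) ->
  I (\prod_(i <- r | Q i) F i - \prod_(i <- r | Q i) G i).
Proof.
move=> h; apply: (big_ind2 (fun x y => I (x - y))) => // [|x y x' y'].
  by rewrite subrr; apply: ideal0.
exact: ideal_cong_mul.
Qed.

Lemma ideal_cong_exp x y m : I (x - y) -> I (x ^+ m - y ^+ m).
Proof.
by move=> h; rewrite -(card_ord m) -!prodr_const; apply: ideal_cong_prod.
Qed.

Lemma ideal_quotient (a : E) : is_ideal [set w | I (a * w)].
Proof.
split=> [|x y|b x] /=; first by rewrite mulr0; apply: ideal0.
- by rewrite mulrDr; apply: idealD.
- by move=> h; rewrite mulrCA; apply: idealMl.
Qed.

End IdealCongruence.

Section FrobeniusSums.
Variables (E : comNzRingType) (p : nat) (hp : p \in [pchar E]) (e : nat).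

Lemma frobD (x y : E) : (x + y) ^+ (p ^ e) = x ^+ (p ^ e) + y ^+ (p ^ e).
Proof.
rewrite exprDn_pchar // pnatX (eq_pnat _ (pcharf_eq hp)).
by rewrite pnat_id ?(pcharf_prime hp).
Qed.

Lemma frob0 : (0 : E) ^+ (p ^ e) = 0.
Proof. by rewrite expr0n expn_eq0 eqn0Ngt (prime_gt0 (pcharf_prime hp)). Qed.

Lemma frobN (x : E) : (- x) ^+ (p ^ e) = - x ^+ (p ^ e).
Proof. by apply/eqP; rewrite -addr_eq0 -frobD addNr frob0. Qed.

Lemma frobB (x y : E) : (x - y) ^+ (p ^ e) = x ^+ (p ^ e) - y ^+ (p ^ e).
Proof. by rewrite frobD frobN. Qed.

Lemma frob_sum (T : Type) (r : seq T) (Q : pred T) (F : T -> E) :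
  (\sum_(i <- r | Q i) F i) ^+ (p ^ e) = \sum_(i <- r | Q i) F i ^+ (p ^ e).
Proof. by apply: (big_morph (fun x => x ^+ (p ^ e))); [apply: frobD | apply: frob0]. Qed.

End FrobeniusSums.

(** One step of fraction-free elimination, with pivot a in the corner. *)
Lemma det_pivot (E : comNzRingType) c (D : 'M[E]_(1 + c)) :
  let a := D (lshift c 0) (lshift c 0) in
  a ^+ c * \det D = a * \det (a *: drsubmx D - dlsubmx D *m ursubmx D).
Proof.
move=> a; have ea : ulsubmx D = a%:M by rewrite [LHS]mx11_scalar !mxE.
pose M : 'M[E]_(1 + c) := block_mx 1%:M 0 (- dlsubmx D) a%:M.
have <- : \det M = a ^+ c by rewrite det_lblock det1 mul1r det_scalar.
rewrite -det_mulmx -[X in M *m X]submxK mulmx_block ea.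
rewrite !mul1mx !mul0mx !addr0 mulNmx mul_mx_scalar mul_scalar_mx addNr.
by rewrite det_ublock det_scalar1 mulNmx mul_scalar_mx addrC.
Qed.

Lemma det_power_mod_regular (E : comNzRingType) (p : nat) (hp : p \in [pchar E])
    (e c : nat) (N : set E) (D : 'M[E]_(1 + c)) (z : 'I_(1 + c) -> E) :
  let r := (p ^ e).-1 in
  let a := D (lshift c 0) (lshift c 0) in
  is_ideal N -> (forall j, N (z j ^+ (p ^ e))) ->
  (forall w, N (a * w) -> N w) ->
  (forall (D' : 'M[E]_c) (z' : 'I_c -> E), (forall j, N (z' j ^+ (p ^ e))) ->
     N (\prod_i (\sum_j D' i j * z' j) ^+ r - \det D' ^+ r * \prod_j z' j ^+ r)) ->
  N (\prod_i (\sum_j D i j * z j) ^+ r - \det D ^+ r * \prod_j z j ^+ r).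
Proof.
move=> r a hN zN reg IH; set l := fun i => \sum_j D i j * z j.
have q1 : r.+1 = (p ^ e)%N.
  by rewrite prednK // expn_gt0 (prime_gt0 (pcharf_prime hp)).
pose l0 := l (lshift c 0); pose z0 := z (lshift c 0).
pose z' j := z (rshift 1 j); pose l' i := l (rshift 1 i).
pose D' := a *: drsubmx D - dlsubmx D *m ursubmx D.
have l0N : N (l0 ^+ (p ^ e)).
  rewrite /l0 /l (frob_sum hp); apply: ideal_sum => // j _.
  by rewrite exprMn; apply: idealMl.
have el0 : l0 = a * z0 + \sum_j D (lshift c 0) (rshift 1 j) * z' j.
  by rewrite /l0 /l big_split_ord big_ord1.
have el' i : \sum_j D' i j * z' j = a * l' i - D (rshift 1 i) (lshift c 0) * l0.
  rewrite /l' el0 /l big_split_ord big_ord1 /= -/z0 !mulrDr opprD addrACA.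
  rewrite mulrCA subrr add0r !mulr_sumr -sumrB; apply: eq_bigr => j _.
  by rewrite !mxE big_ord1 !mxE mulrBl !mulrA.
(* modulo l0 the pivoted forms are multiples of the original ones *)
have h1 : N (l0 ^+ r * (\prod_i (a * l' i) ^+ r - \prod_i (\sum_j D' i j * z' j) ^+ r)).
  apply: (ideal_cong_prod (ideal_quotient hN (l0 ^+ r))) => i _.
  apply: (ideal_cong_exp (ideal_quotient hN (l0 ^+ r))) => /=.
  rewrite el' opprB addrC subrK mulrCA -exprSr q1; exact: idealMl.
have h2 : N (l0 ^+ r * (\prod_i (\sum_j D' i j * z' j) ^+ r
                        - \det D' ^+ r * \prod_j z' j ^+ r)).
  by apply: idealMl => //; apply: (IH D') => j; apply: zN.
have h3 : N ((\prod_j z' j ^+ r) * (l0 ^+ r - (a * z0) ^+ r)).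
  apply: (ideal_cong_exp (ideal_quotient hN (\prod_j z' j ^+ r))) => /=.
  rewrite el0 addrAC subrr add0r mulr_sumr; apply: ideal_sum => // j _.
  rewrite (bigD1 j) //= mulrAC mulrCA mulrA; apply: idealMr => //.
  by rewrite -mulrA -exprSr q1; apply: idealMl => //; apply: zN.
have rega K w : N (a ^+ K * w) -> N w.
  by elim: K => [|K IHK]; rewrite ?expr0 ?mul1r // exprS -mulrA => /reg/IHK.
apply: (rega (c * r)%N); rewrite !big_split_ord !big_ord1 /= -/l0 -/z0.
have -> : a ^+ (c * r) * (l0 ^+ r * \prod_i l' i ^+ r - \det D ^+ r * (z0 ^+ r * \prod_j z' j ^+ r))
  = (l0 ^+ r * (\prod_i (a * l' i) ^+ r - \prod_i (\sum_j D' i j * z' j) ^+ r)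
     + l0 ^+ r * (\prod_i (\sum_j D' i j * z' j) ^+ r - \det D' ^+ r * \prod_j z' j ^+ r))
    + \det D' ^+ r * ((\prod_j z' j ^+ r) * (l0 ^+ r - (a * z0) ^+ r)).
  rewrite -mulrDr subrKA.
  have -> : \prod_i (a * l' i) ^+ r = a ^+ (c * r) * \prod_i l' i ^+ r.
    under eq_bigr do rewrite exprMn.
    by rewrite big_split /= prodr_const card_ord -exprM mulnC.
  have e1 : a ^+ (c * r) * \det D ^+ r = a ^+ r * \det D' ^+ r.
    by rewrite exprM -exprMn det_pivot exprMn.
  have -> : \det D' ^+ r * (\prod_j z' j ^+ r * (l0 ^+ r - (a * z0) ^+ r))
      = l0 ^+ r * (\det D' ^+ r * \prod_j z' j ^+ r)
        - a ^+ (c * r) * \det D ^+ r * (z0 ^+ r * \prod_j z' j ^+ r).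
    rewrite e1 exprMn !mulrBr; congr (_ - _); first by rewrite mulrA mulrC.
    by rewrite [a ^+ r * _]mulrC -mulrA mulrCA (mulrC (\prod_j _)) !mulrA.
  by rewrite [in RHS]mulrBr subrKA mulrBr (mulrCA (a ^+ _)) -mulrA.
apply: idealD => //; first exact: idealD.
exact: idealMl.
Qed.

(** Row operations do not change a product of (q-1)-st powers of linear forms
    modulo their q-th powers, so elimination reduces to size c as soon as the
    pivot is regular modulo N.  Adding an indeterminate to the pivot makes it
    regular, and is undone at the end by specializing it to zero. *)
Lemma det_power_mod (E : comNzRingType) (p : nat) (hp : p \in [pchar E])
    (e c : nat) (N : set E) (D : 'M[E]_c) (z : 'I_c -> E) :
  is_ideal N -> (forall j, N (z j ^+ (p ^ e))) ->
  N (\prod_i (\sum_j D i j * z j) ^+ (p ^ e).-1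
     - \det D ^+ (p ^ e).-1 * \prod_j z j ^+ (p ^ e).-1).
Proof.
set r := (p ^ e).-1.
elim: c E hp N D z => [|c IH] E hp N D z hN zN.
  by rewrite !big_ord0 det_mx00 expr1n mul1r subrr; apply: ideal0.
pose NT : set {poly E} := [set w | forall i, N w`_i].
have hNT : is_ideal NT.
  split=> [i|v w hv hw i|v w hw i]; rewrite ?coef0 ?coefD ?coefM.
  - exact: ideal0.
  - exact: idealD.
  - by apply: ideal_sum => // j _; apply: idealMl.
pose o : 'I_(1 + c) := lshift c 0.
pose DT : 'M[{poly E}]_(1 + c) :=
  \matrix_(i < 1 + c, j < 1 + c) ((D i j)%:P + ((i == o) && (j == o))%:R * 'X).
have hpT : p \in [pchar {poly E}] := rmorph_pchar polyC hp.
have zT j : NT ((z j)%:P ^+ (p ^ e)).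
  by move=> i; rewrite -polyC_exp coefC; case: eqP => // _; apply: ideal0.
have regT w : NT (DT o o * w) -> NT w.
  rewrite mxE eqxx mul1r => hw.
  have hw' i : N (D o o * w`_i.+1 + w`_i).
    by have := hw i.+1; rewrite mulrDl coefD coefCM coefXM.
  move=> i; have [m] := ubnP (size w - i)%N; elim: m i => // m IHm i.
  have [le _|lt him] := leqP (size w) i; first by rewrite nth_default //; apply: ideal0.
  have /(idealMl (D o o) hN) hi : N w`_i.+1.
    by apply: IHm; rewrite subnS prednK ?subn_gt0.
  by have := idealB hN (hw' i) hi; rewrite addrAC subrr add0r.
have /(_ 0%N) := det_power_mod_regular hpT hNT zT regT
  (fun D' z' => IH _ hpT NT D' z' hNT).
rewrite -/r -horner_coef0 -[_.[0]]/(horner_eval 0 _) rmorphB rmorphM rmorphXn.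
rewrite !rmorph_prod -det_map_mx /=.
have -> : map_mx (horner_eval 0) DT = D.
  by apply/matrixP => i j; rewrite !mxE /horner_eval hornerD hornerC hornerM hornerX mulr0 addr0.
rewrite (eq_bigr (fun i => (\sum_j D i j * z j) ^+ r)) => [|i _].
  rewrite [X in _ - _ * X](eq_bigr (fun j => z j ^+ r)) // => j _.
  by rewrite -polyC_exp /horner_eval hornerC.
rewrite rmorphXn rmorph_sum /=; congr (_ ^+ _); apply: eq_bigr => j _.
rewrite /horner_eval hornerM hornerC !mxE hornerD hornerC hornerM hornerX.
by rewrite mulr0 addr0.
Qed.

(** * The top coefficient modulo Frobenius powers of the variables *)

Section MpolyInduction.
Variables (R : comNzRingType) (n : nat).
Implicit Types (w : {mpoly R[n]}) (m : 'X_{1..n}).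

Lemma mpoly_alg_ind (K : {mpoly R[n]} -> Prop) :
  (forall c, K c%:MP) -> (forall i, K 'X_i) ->
  (forall a b, K a -> K b -> K (a + b)) ->
  (forall a b, K a -> K b -> K (a * b)) -> forall w, K w.
Proof.
move=> KC KX KD KM w.
have K1 : K 1 by rewrite -mpolyC1.
elim/mpolyind: w => [|c m w _ _ Kw]; first by rewrite -mpolyC0.
apply: KD => //; rewrite -mul_mpolyC; apply: (KM) => //; rewrite mpolyXE_id.
apply: (big_ind K) => // i _; elim: (m i) => [|j IH]; first by rewrite expr0.
by rewrite exprS; apply: KM.
Qed.

Lemma mcoeffMX_le w (u m : 'X_{1..n}) :
  (w * 'X_[u])@_m = if (u <= m)%MM then w@_(m - u) else 0.
Proof.
case: ifPn => [um|num]; first by rewrite -[in LHS](submK um) addmC mcoeffMX.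
elim/mpolyind: w => [|c m' w _ _ IH]; first by rewrite mul0r mcoeff0.
rewrite mulrDl mcoeffD IH addr0 -scalerAl -mpolyXD mcoeffZ mcoeffX.
have [e|] := eqVneq; last by rewrite mulr0.
by rewrite -e lem_addl in num.
Qed.

Lemma mcoeff0M (u w : {mpoly R[n]}) : (u * w)@_0 = u@_0 * w@_0.
Proof. by case: (@mcoeff0_is_multiplicative n R) => + _; apply. Qed.

Lemma mcoeff0_sumX (D : 'I_n -> {mpoly R[n]}) : (\sum_j D j * 'X_j)@_0 = 0.
Proof.
rewrite (raddf_sum (mcoeff 0)) big1 // => i _ /=.
by rewrite mcoeff0M mcoeffX mnm1_eq0 mulr0.
Qed.

End MpolyInduction.

Section TopCoefficient.
Variables (R : comNzRingType) (p : nat) (hp : p \in [pchar R]) (n e : nat).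
Local Notation q := (p ^ e)%N.
Local Notation E := {mpoly R[n]}.

Definition top_mnm : 'X_{1..n} := [multinom q.-1 | i < n].

(** The coefficient of the product of all X_i^(q-1).  As a functional on the
    finite free R-algebra R[X] / (X_1^q, ..., X_n^q) it generates the R-linear
    forms, and on Taylor expansions it is the q-th power of the generator of
    Hom(F^e_* k[x], k[x]). *)
Definition topcoef (w : E) : R := w@_top_mnm.

Lemma frob_pred : q.-1.+1 = q.
Proof. by rewrite prednK // expn_gt0 (prime_gt0 (pcharf_prime hp)). Qed.

Lemma pchar_mpoly : p \in [pchar {mpoly R[n]}].
Proof. exact: (rmorph_pchar (@mpolyC n R) hp). Qed.

Lemma topcoefD u w : topcoef (u + w) = topcoef u + topcoef w.
Proof. exact: mcoeffD. Qed.

Lemma topcoef0 : topcoef 0 = 0. Proof. exact: mcoeff0. Qed.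

Lemma topcoefZ c w : topcoef (c%:MP * w) = c * topcoef w.
Proof. exact: mcoeffCM. Qed.

Lemma topcoef_top w : topcoef ((\prod_i 'X_i ^+ q.-1) * w) = w@_0.
Proof.
have -> : \prod_i 'X_i ^+ q.-1 = 'X_[R, top_mnm].
  by rewrite mpolyXE_id; apply: eq_bigr => i _; rewrite mnmE.
by rewrite mulrC /topcoef -[X in _@_X]addm0 mcoeffMX.
Qed.

Lemma topcoef_var i w : topcoef ('X_i ^+ q * w) = 0.
Proof.
rewrite mulrC mpolyXn /topcoef mcoeffMX_le; case: ifPn => // /mnm_lepP /(_ i).
by rewrite mulmnE mnm1E eqxx mul1n mnmE -ltnS frob_pred ltnn.
Qed.

(** Modulo the X_i^q, a q-th power is the q-th power of its constant term. *)
Lemma topcoef_frob (s w : E) : topcoef (s ^+ q * w) = s@_0 ^+ q * topcoef w.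
Proof.
have hpE := pchar_mpoly.
elim/mpoly_alg_ind: s w => [c|i|s t IHs IHt|s t IHs IHt] w.
- by rewrite -(rmorphXn (@mpolyC n R)) topcoefZ mcoeffC eqxx mulr1.
- rewrite topcoef_var mcoeffX; have -> : (U_(i) == 0)%MM = false.
    by apply/negbTE; rewrite mnm1_eq0.
  by rewrite (frob0 hp) mul0r.
- by rewrite (frobD hpE) mulrDl topcoefD IHs IHt mcoeffD (frobD hp) mulrDl.
- by rewrite exprMn -mulrA IHs IHt mcoeff0M exprMn mulrA.
Qed.

End TopCoefficient.

Section Taylor.
Variables (k : fieldType) (R : comAlgType k) (p : nat) (hp : p \in [pchar R]).
Variables (n e : nat) (v : 'I_n -> R).
Local Notation q := (p ^ e)%N.
Local Notation S := {mpoly k[n]}.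
Local Notation E := {mpoly R[n]}.
Local Notation ev := (mmap (GRing.in_alg R) v).

(** The map x_i |-> v_i + X_i.  It identifies R (x) k[x] with R[X], the
    differences 1 (x) x_i - v_i (x) 1 becoming the variables. *)
Definition taylor : S -> E :=
  mmap (@mpolyC n R \o GRing.in_alg R) (fun i => 'X_i + (v i)%:MP).

HB.instance Definition _ := GRing.RMorphism.copy taylor
  (mmap (@mpolyC n R \o GRing.in_alg R) (fun i => 'X_i + (v i)%:MP)).

Lemma taylorC c : taylor c%:MP = (c%:A)%:MP.
Proof. by rewrite /taylor mmapC. Qed.

Lemma taylorX i : taylor 'X_i = 'X_i + (v i)%:MP.
Proof. by rewrite /taylor mmapX mmap1U. Qed.

Lemma taylorD a b : taylor (a + b) = taylor a + taylor b.
Proof. exact: rmorphD. Qed.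

Lemma taylorM a b : taylor (a * b) = taylor a * taylor b.
Proof. exact: rmorphM. Qed.

Lemma evD a b : ev (a + b) = ev a + ev b. Proof. exact: rmorphD. Qed.

Lemma evM a b : ev (a * b) = ev a * ev b. Proof. exact: rmorphM. Qed.

Lemma evX i : ev 'X_i = v i.
Proof. by rewrite mmapX mmap1U. Qed.

Lemma taylor_order1 (b : S) : exists D : 'I_n -> E,
  taylor b = (ev b)%:MP + \sum_j D j * 'X_j /\
  forall j, (D j)@_0 = ev b^`M(j).
Proof.
elim/mpoly_alg_ind: b => [c|i|a b [A [eA dA]] [B [eB dB]]|a b [A [eA dA]] [B [eB dB]]].
- exists (fun=> 0); rewrite taylorC mmapC big1 ?addr0; last by move=> i _; rewrite mul0r.
  by split=> // j; rewrite mderivC mcoeff0 rmorph0.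
- exists (fun j => (i == j)%:R); rewrite taylorX evX addrC; split.
    rewrite (bigD1 i) //= eqxx mul1r big1 ?addr0 // => j.
    by rewrite eq_sym => /negbTE->; rewrite mul0r.
  move=> j; rewrite /= mderivX mnm1E.
  have [->|_] := eqVneq i j; last by rewrite !mulr0n mcoeff0 scale0r rmorph0.
  have -> : (U_(j) - U_(j) = 0 :> 'X_{1..n})%MM.
    by apply/mnmP => l; rewrite mnmBE subnn mnm0E.
  by rewrite !mulr1n mcoeff1 eqxx scale1r mpolyX0 [RHS]rmorph1.
- exists (fun j => A j + B j); rewrite taylorD evD; split.
    rewrite eA eB addrACA mpolyCD -big_split; congr (_ + _).
    by apply: eq_bigr => j _; rewrite mulrDl.
  by move=> j; rewrite mcoeffD dA dB mderivD evD.
- exists (fun j => (ev a)%:MP * B j + A j * taylor b); rewrite taylorM evM; split.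
    rewrite eA mulrDl {1}eB mulrDr -addrA mpolyCM; congr (_ + _).
    rewrite mulr_sumr mulr_suml -big_split; apply: eq_bigr => j _.
    by rewrite mulrDl mulrA [X in _ + X]mulrAC.
  move=> j; rewrite mcoeffD !mcoeff0M mcoeffC eqxx mulr1 dA dB eB mcoeffD.
  by rewrite mcoeffC eqxx mulr1 mcoeff0_sumX addr0 mderivM evD !evM addrC.
Qed.

Lemma taylor_at0 b : (taylor b)@_0 = ev b.
Proof.
have [D [-> _]] := taylor_order1 b.
by rewrite mcoeffD mcoeffC eqxx mulr1 mcoeff0_sumX addr0.
Qed.

Lemma topcoef_taylor_frob (s : S) w :
  topcoef p e (taylor s ^+ q * w) = ev s ^+ q * topcoef p e w.
Proof. by rewrite (topcoef_frob hp) taylor_at0. Qed.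

Lemma taylor_leading (m : 'X_{1..n}) m' : (mdeg m <= mdeg m')%N ->
  (taylor 'X_[m])@_m' = (m == m')%:R.
Proof.
have [d] := ubnP (mdeg m); elim: d m m' => // d IH m m' dm dm'.
have [m0|] := eqVneq m 0%MM.
  by rewrite m0 mpolyX0 (rmorph1 taylor) mcoeff1 [in RHS]eq_sym.
case: (pickP (fun i => m i != 0%N)) => [i mi _|m0]; last first.
  by case/eqP; apply/mnmP => i; rewrite mnm0E; apply/eqP; move/negbFE: (m0 i).
have im : (U_(i) <= m)%MM by rewrite lep1mP.
rewrite -(submK im) in dm dm' *; set m1 := (m - U_(i))%MM in dm dm' *.
move: dm dm'; rewrite mdegD mdeg1 addn1 ltnS => dm dm'.
rewrite mpolyXD taylorM taylorX mulrDr mcoeffD mcoeffMX_le.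
rewrite [_ * _%:MP]mulrC mcoeffCM IH ?(ltnW dm') //.
have -> : (m1 == m') = false.
  by apply/negbTE; apply: contraTneq dm' => ->; rewrite ltnn.
rewrite mulr0 addr0; case: ifPn => [im'|nim].
  have em' : mdeg m' = (mdeg (m' - U_(i))).+1.
    by rewrite -{1}(submK im') mdegD mdeg1 addn1.
  by rewrite -{2}(submK im') eqm_add2r IH // -ltnS -em'.
by case: eqP => // em; rewrite -em lem_addl in nim.
Qed.

Hypothesis hk : perfect_field k p.

Lemma perfect_frob (c : k) : exists a, a ^+ q = c.
Proof.
elim: e => [|f [a <-]]; first by exists c; rewrite expn0 expr1.
by have [b <-] := hk a; exists b; rewrite expnS exprM.
Qed.

(** Only the monomials with all exponents congruent to -1 modulo q contribute,
    each one a q-th power because the coefficients in k have q-th roots. *)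
Lemma topcoef_taylor_root (b : S) :
  exists c, topcoef p e (taylor b) = ev c ^+ q.
Proof.
elim/mpolyind: b => [|c m b _ _ [d ed]].
  by exists 0; rewrite !rmorph0 topcoef0 (frob0 hp).
have [a ea] := perfect_frob c.
pose m' : 'X_{1..n} := [multinom (m i %/ q)%N | i < n].
pose m1 : 'X_{1..n} := [multinom (m i %% q)%N | i < n].
have em : m = (m' *+ q + m1)%MM.
  by apply/mnmP => i; rewrite mnmDE mulmnE !mnmE -divn_eq.
have q0 : (0 < q)%N by rewrite -(frob_pred hp).
have hm1 : (mdeg m1 <= mdeg (top_mnm p n e))%N.
  rewrite !mdegE; apply: leq_sum => i _; rewrite !mnmE.
  by rewrite -ltnS (frob_pred hp) ltn_mod.
exists ((m1 == top_mnm p n e)%:R%:MP * (a%:MP * 'X_[m']) + d).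
rewrite taylorD topcoefD evD ed (frobD hp); congr (_ + _).
rewrite em mpolyXD -mpolyXn -ea -mul_mpolyC (rmorphXn (@mpolyC n k)) mulrA -exprMn.
rewrite taylorM (rmorphXn taylor) topcoef_taylor_frob evM exprMn mulrC; congr (_ * _).
rewrite /topcoef taylor_leading // mmapC.
by case: (_ == _); rewrite /= ?scale1r ?expr1n // scale0r (frob0 hp).
Qed.

End Taylor.

(** * The trace attached to a sequence of relations *)

Section Trace.
Variables (k : fieldType) (p : nat) (hpk : p \in [pchar k]).
Variables (hk : perfect_field k p) (R : comAlgType k) (X : eft_presentation R).
Variables (hred : reduced R) (d : nat) (hd : eft_equidimensional X d) (e : nat).
Let hp : p \in [pchar R] := pchar_base R hpk.
Local Notation q := (p ^ e)%N.
Local Notation n := (eft_n X).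
Local Notation S := {mpoly k[n]}.
Local Notation E := {mpoly R[n]}.
Local Notation ev := (@eft_ev k R X).
Local Notation tay := (taylor (@eft_v k R X)).
Local Notation top := (topcoef p e).

Lemma eft_evM a b : ev (a * b) = ev a * ev b. Proof. exact: rmorphM. Qed.

Lemma eft_evD a b : ev (a + b) = ev a + ev b. Proof. exact: rmorphD. Qed.

Lemma eft_evX a m : ev (a ^+ m) = ev a ^+ m. Proof. exact: rmorphXn. Qed.

Lemma eft_ev_relation i : ev (eft_f i) = 0.
Proof.
apply/eft_ker; exists 1; first exact: eft_S1.
by rewrite mul1r; apply: ideal_gen_sub; exists i.
Qed.

Lemma eft_prime_preimage (P : set R) : prime_ideal P -> prime_ideal (ev @^-1` P).
Proof.
move=> [hP P1 PM]; split=> [||x y] /=.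
- split=> [|x y|a x] /=.
  + by rewrite [ev 0]rmorph0; apply: ideal0.
  + by rewrite eft_evD; apply: idealD.
  + by rewrite eft_evM; apply: idealMl.
- by rewrite [ev 1]rmorph1.
- by rewrite eft_evM; apply: PM.
Qed.

Lemma frob_inj_reduced (x y : R) : x ^+ q = y ^+ q -> x = y.
Proof.
move=> exy; apply/eqP; rewrite -subr_eq0; apply/eqP; apply: (hred (n := q)).
by rewrite (frobB hp) exy subrr.
Qed.

(** Denominators can be taken to be q-th powers, which pass through p^(-e)-linear
    maps. *)
Lemma eft_fraction r : exists b s, eft_S s /\ r * ev s ^+ q = ev b.
Proof.
have [b [s [Ss e_rs]]] := eft_surj X r; exists (b * s ^+ q.-1), s; split=> //.
by rewrite eft_evM eft_evX -e_rs -mulrA -exprS (frob_pred hp).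
Qed.

(** The largest ideal on which topcoef vanishes; it contains the X_j^q. *)
Lemma topcoef_annihilator_ideal : is_ideal [set w : E | forall u, top (w * u) = 0].
Proof.
split=> [u|x y hx hy u|a x hx u] /=; first by rewrite mul0r topcoef0.
- by rewrite mulrDl topcoefD hx hy addr0.
- by rewrite -mulrA mulrCA hx.
Qed.

Section Relations.
Variables (f : 'I_(n - d) -> S) (f0 : forall i, ev (f i) = 0).
Let F : S := \prod_i f i ^+ q.-1.

(** This vanishing is where the equidimensionality and the reducedness of R
    enter.  Near a minimal prime P the kernel of ev is generated by n - d
    elements w, and F is a product of (n - d)(q - 1) combinations of them;
    multiplied by one more, it falls into the ideal of the powers w_j^q, which
    topcoef sends into P. *)
Lemma topcoef_relation b : ev b = 0 -> top (tay (F * b)) = 0.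
Proof.
move=> b0; apply: contrapT => nz.
have [P [minP]] := reduced_minimal_prime hred nz; apply.
have [[hP _] [chainP _]] := (minP, hd minP).
have hp' := eft_prime_preimage hP.
have [idP _ PM] := hP; have [idp _ _] := hp'.
have [w [wP gen]] := prime_locally_generated hp' chainP.
have evP a : ev a = 0 -> (ev @^-1` P) a by move=> /= ->; apply: ideal0.
have /choice[s hs] : forall i, exists s, ~ P (ev s) /\
    exists a : 'I_(n - d) -> S, s * f i = \sum_j a j * w j.
  by move=> i; have [s] := gen (f i) (evP _ (f0 i)); exists s.
have /choice[M hM] : forall i, exists a : 'I_(n - d) -> S,
    s i * f i = \sum_j a j * w j by move=> i; case: (hs i).
have [sb Psb [a ea]] := gen b (evP _ b0).
pose N : set S := [set x | forall u, P (top (tay (x * u)))].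
have hN : is_ideal N.
  split=> [u|x y hx hy u|c x hx u].
  - by rewrite mul0r (rmorph0 tay) topcoef0; apply: ideal0.
  - by rewrite mulrDl taylorD topcoefD; apply: (idealD idP).
  - by rewrite -mulrA mulrCA.
have topX x u : top (tay (x ^+ q * u)) = ev x ^+ q * top (tay u).
  by rewrite taylorM (rmorphXn tay) (topcoef_taylor_frob hp).
have wN j : N (w j ^+ q).
  move=> u; rewrite topX; apply: (idealMr _ idP).
  by rewrite -(frob_pred hp) exprS; apply: (idealMr _ idP); apply: wP.
have hdet := det_power_mod (pchar_mpoly hpk n) (\matrix_(i, j) M i j) hN wN.
have hprod : N (\prod_i (s i * f i) ^+ q.-1 * (sb * b)).
  rewrite (eq_bigr (fun i => (\sum_j (\matrix_(i, j) M i j) i j * w j) ^+ q.-1)); last first.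
    by move=> i _; rewrite hM; congr (_ ^+ _); apply: eq_bigr => j _; rewrite mxE.
  rewrite -[X in N (X * _)](subrK (\det (\matrix_(i, j) M i j) ^+ q.-1 * \prod_j w j ^+ q.-1)).
  rewrite mulrDl; apply: (idealD hN); first exact: (idealMr _ hN).
  rewrite ea mulr_sumr; apply: (ideal_sum _ hN) => j _.
  rewrite -mulrA; apply: (idealMl _ hN); rewrite (bigD1 j) //= mulrAC.
  by apply: (idealMr _ hN); rewrite mulrCA -exprSr (frob_pred hp); apply: (idealMl _ hN).
pose sigma := (\prod_i s i) ^+ q.-1 * sb.
have Psigma : ~ P (ev sigma).
  rewrite eft_evM eft_evX => /PM[]; last exact: Psb.
  apply: prime_exp => //.
  by apply: (prime_prod (P := ev @^-1` P)) => // i _; case: (hs i).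
have hsigma : N (sigma ^+ q * (F * b)).
  rewrite -(frob_pred hp) exprSr -mulrA; apply: (idealMl _ hN).
  rewrite (_ : sigma * _ = \prod_i (s i * f i) ^+ q.-1 * (sb * b)) //.
  have -> : \prod_i (s i * f i) ^+ q.-1 = (\prod_i s i) ^+ q.-1 * F.
    by rewrite -prodrXl -big_split; apply: eq_bigr => i _; rewrite exprMn.
  by rewrite /sigma mulrACA.
have := hsigma 1; rewrite mulr1 topX.
by apply: prime_mulK => //; apply: prime_exp.
Qed.

Lemma topcoef_relation_eq b b' : ev b = ev b' -> top (tay (F * b)) = top (tay (F * b')).
Proof.
move=> e_b; apply/eqP; rewrite -subr_eq0; apply/eqP.
have <- : top (tay (F * (b - b'))) = top (tay (F * b)) - top (tay (F * b')).
  by rewrite mulrBr (rmorphB tay) [LHS]mcoeffB.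
apply: topcoef_relation; rewrite [ev _]rmorphB /=.
by apply/eqP; rewrite subr_eq0; apply/eqP.
Qed.

(** Fedder's construction: premultiplied by F, the generator of
    Hom(F^e_* k[x], k[x]) descends to a map t in Hom(F^e_* R, R).  As R is
    reduced, t is determined by its q-th power, so additivity and
    p^(-e)-linearity are inherited from topcoef. *)
Lemma trace_exists : exists t : R -> R,
  [/\ forall r r', t (r + r') = t r + t r',
      forall s r, t (s ^+ q * r) = s * t r
    & forall b, t (ev b) ^+ q = top (tay (F * b))].
Proof.
have topX x u : top (tay (F * (x ^+ q * u))) = ev x ^+ q * top (tay (F * u)).
  have -> : F * (x ^+ q * u) = x ^+ q * (F * u) by rewrite mulrCA.
  by rewrite [tay _]taylorM (rmorphXn tay) (topcoef_taylor_frob hp).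
have /choice[t ht] : forall r, exists y, forall b s, r * ev s ^+ q = ev b ->
    y ^+ q * ev s ^+ q = top (tay (F * b)).
  move=> r; have [b [s [Ss e_rs]]] := eft_fraction r.
  have [u us] := eft_unit Ss.
  have [c ec] := topcoef_taylor_root hp e (@eft_v k R X) hk (F * b).
  exists (ev c * u) => b' s' e_rs'.
  have eb : ev (s ^+ q * b') = ev (s' ^+ q * b).
    by rewrite !eft_evM !eft_evX -e_rs -e_rs' mulrCA [RHS]mulrCA (mulrC (ev s ^+ q)).
  have := topcoef_relation_eq eb; rewrite !topX ec => eq_s.
  rewrite exprMn -[RHS]mul1r -(expr1n _ q) -us exprMn -[RHS]mulrA eq_s.
  by rewrite [RHS]mulrA [RHS]mulrC mulrA.
have tP r y b s : eft_S s -> r * ev s ^+ q = ev b ->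
    y ^+ q * ev s ^+ q = top (tay (F * b)) -> t r = y.
  move=> Ss e_rs e_y; apply: frob_inj_reduced; have [u us] := eft_unit Ss.
  have su : ev s ^+ q * u ^+ q = 1 by rewrite -exprMn mulrC us expr1n.
  have : t r ^+ q * ev s ^+ q = y ^+ q * ev s ^+ q by rewrite e_y; apply: ht.
  move/(congr1 ( *%R^~ (u ^+ q))); rewrite -!mulrA su !mulr1.
  exact.
exists t; split=> [r r'|x r|b].
- have [b [s [Ss es]]] := eft_fraction r; have [b' [s' [Ss' es']]] := eft_fraction r'.
  apply: (tP _ _ (s' ^+ q * b + s ^+ q * b') (s * s')); first exact: eft_SM.
    rewrite eft_evD !eft_evM !eft_evX -es -es' exprMn mulrDl; congr (_ + _).
      by rewrite [LHS]mulrA [LHS]mulrC.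
    by rewrite mulrCA.
  rewrite mulrDr taylorD topcoefD !topX -(ht _ _ _ es) -(ht _ _ _ es').
  rewrite (frobD hp) eft_evM exprMn mulrDl; congr (_ + _).
    by rewrite [LHS]mulrA [LHS]mulrC.
  by rewrite mulrCA.
- have [b [s [Ss es]]] := eft_fraction r; have [c [s' [Ss' es']]] := eft_surj X x.
  apply: (tP _ _ (c ^+ q * b) (s' * s)); first exact: eft_SM.
    by rewrite !eft_evM !eft_evX -es -es' !exprMn mulrACA.
  by rewrite topX -(ht _ _ _ es) -es' eft_evM !exprMn mulrACA.
- have := ht (ev b) b 1; rewrite [ev 1]rmorph1 !expr1n !mulr1; exact.
Qed.

(** Multiplied by the X_j^(q-1) with j outside the image of h, the expansion of
    f_i only counts through its component along the X_(h j), which has the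
    entries of the Jacobian minor as constant terms; the determinant of these
    components is what det_power_mod extracts. *)
Lemma topcoef_jacobian (h : 'I_(n - d) -> 'I_n) w : injective h ->
  top (tay F * (\prod_(j | j \notin codom h) 'X_j ^+ q.-1) * w)
  = ev (\det (\matrix_(i, j) (f i)^`M(h j))) ^+ q.-1 * w@_0.
Proof.
move=> hinj; set Y := \prod_(j | _) _.
have /choice[D hD] := fun i => taylor_order1 (@eft_v k R X) (f i).
have eD i : tay (f i) = \sum_j D i j * 'X_j.
  by case: (hD i) => -> _; rewrite [mmap _ _ _]f0 mpolyC0 add0r.
pose N : set E := [set u | forall v, top (u * v) = 0].
have hN : is_ideal N := topcoef_annihilator_ideal.
have hNY := ideal_quotient hN Y.
have NX j : N ('X_j ^+ q) by move=> v; apply: (topcoef_var hp).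
pose DM : 'M[E]_(n - d) := \matrix_(i, j) D i (h j).
have uh : uniq (codom h) by apply/injectiveP.
have codom_sum (G : 'I_n -> E) : \sum_(j in codom h) G j = \sum_i G (h i).
  by rewrite -(big_uniq _ uh) big_image.
have codom_prod (G : 'I_n -> E) : \prod_(j in codom h) G j = \prod_i G (h i).
  by rewrite -(big_uniq _ uh) big_image.
have hdet := det_power_mod (pchar_mpoly hp n) (e := e) DM hNY
  (fun j : 'I_(n - d) => idealMl Y hN (NX (h j))).
have hF : N (Y * (tay F - \prod_i (\sum_j DM i j * 'X_(h j)) ^+ q.-1)).
  rewrite /F (rmorph_prod tay); apply: (ideal_cong_prod hNY) => i _.
  rewrite (rmorphXn tay); apply: (ideal_cong_exp hNY) => /=.
  rewrite eD (bigID (mem (codom h))) /= codom_sum addrAC.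
  under [X in _ - X]eq_bigr do rewrite mxE.
  rewrite subrr add0r mulr_sumr; apply: (ideal_sum _ hN) => j hj.
  rewrite /Y (bigD1 j) //= mulrAC mulrCA -exprSr (frob_pred hp).
  by apply: (idealMr _ hN); apply: (idealMl _ hN).
have /(_ w) := idealD hN hF hdet; rewrite -mulrDr subrKA mulrBr mulrBl.
move/eqP; rewrite [top _]mcoeffB subr_eq0 => /eqP.
rewrite -!/(top _) (mulrC Y) => ->.
have eX : \prod_j 'X_(h j) ^+ q.-1 * Y = \prod_j 'X_j ^+ q.-1 :> E.
  by rewrite -(codom_prod (fun j => 'X_j ^+ q.-1)) /Y [RHS](bigID (mem (codom h))).
rewrite mulrCA (mulrC Y) eX -[X in top X]mulrA mulrCA topcoef_top.
rewrite mcoeff0M; congr (_ * _).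
rewrite (rmorphXn (mcoeff 0)) /=; congr (_ ^+ _).
have -> : ev (\det (\matrix_(i, j) (f i)^`M(h j)))
    = \det (map_mx ev (\matrix_(i, j) (f i)^`M(h j))).
  exact: esym (det_map_mx _ _).
rewrite -(det_map_mx (mcoeff 0)); congr (\det _).
by apply/matrixP => i j; rewrite !mxE; case: (hD i) => _; exact.
Qed.

End Relations.
End Trace.

(** * Linear maps out of the Frobenius pushforward of the tensor square *)

Section ScalarRestriction.
Variables (k : fieldType) (T : comNzRingType) (rho : {rmorphism k -> T}).

(** The ring T as a k-module through rho.  The definition of the tensor square
    tests its elements against bilinear maps into k-modules; a p^(-e)-linear map
    becomes linear once k acts on the target through e-th roots. *)
Definition restrict of {rmorphism k -> T} : Type := T.

HB.instance Definition _ := GRing.Zmodule.on (restrict rho).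

Definition restrict_scale (c : k) (z : restrict rho) : restrict rho :=
  rho c * (z : T).

Fact restrict_scaleA a b z :
  restrict_scale a (restrict_scale b z) = restrict_scale (a * b) z.
Proof. by rewrite /restrict_scale rmorphM mulrA. Qed.

Fact restrict_scale1 : left_id 1 restrict_scale.
Proof. by move=> z; rewrite /restrict_scale rmorph1 mul1r. Qed.

Fact restrict_scaleDr : right_distributive restrict_scale +%R.
Proof. by move=> a u v; apply: mulrDr. Qed.

Fact restrict_scaleDl z : {morph restrict_scale^~ z : a b / a + b}.
Proof. by move=> a b; rewrite /restrict_scale rmorphD mulrDl. Qed.

HB.instance Definition _ := GRing.Zmodule_isLmodule.Build k (restrict rho)
  restrict_scaleA restrict_scale1 restrict_scaleDr restrict_scaleDl.

End ScalarRestriction.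

Section TensorTheory.
Variables (k : fieldType) (R : comAlgType k).
Implicit Types (x y : R) (z w : tensor2 R) (s : seq (R * R)).

Lemma tpureDr x y y' : tpure x (y + y') = tpure x y + tpure x y'.
Proof.
rewrite [RHS]tadd_class; apply/tclassP => M f bf.
by rewrite /tsum big_seq1 big_cons big_seq1 /= (bilinDr bf).
Qed.

Lemma tpureM x x' y y' : tpure (x * x') (y * y') = tpure x y * tpure x' y'.
Proof. by rewrite [RHS]tmul_class. Qed.

Lemma tpureZ (c : k) : tpure c%:A 1 = tpure 1 c%:A :> tensor2 R.
Proof.
apply/tclassP => M f [lf rf]; rewrite /tsum !big_seq1 /=.
have := lf 1 c 1 0; have := rf 1 c 1 0; rewrite !addr0 => -> ->.
have bf : is_bilinear f by [].
have f0r : f 1 0 = 0 by apply: (addrI (f 1 0)); rewrite -(bilinDr bf) !addr0.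
by rewrite (bilin0l bf) f0r.
Qed.

Lemma tclass_sum s : tclass s = \sum_(u <- s) tpure u.1 u.2 :> tensor2 R.
Proof.
elim: s => [|u s IH]; first by rewrite big_nil.
by rewrite big_cons -IH [RHS]tadd_class; case: u.
Qed.

Lemma tensor2_ind (K : tensor2 R -> Prop) :
  K 0 -> (forall x y, K (tpure x y)) ->
  (forall z w, K z -> K w -> K (z + w)) -> forall z, K z.
Proof.
move=> K0 Kp KD z; rewrite -(tclass_repr z) tclass_sum.
by elim/big_ind: _ => //.
Qed.

End TensorTheory.

Section TensorLift.
Variables (k : fieldType) (p : nat) (hpk : p \in [pchar k]).
Variables (hk : perfect_field k p) (R : comAlgType k) (e : nat).
Local Notation q := (p ^ e)%N.
Local Notation hp := (pchar_base R hpk).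
Variables (phi : homF hp e) (t : R -> R) (L : seq (R * R)).
Hypotheses (tD : forall r r', t (r + r') = t r + t r').
Hypotheses (tZ : forall s r, t (s ^+ q * r) = s * t r).

Lemma homF_add (A : comNzRingType) (hA : p \in [pchar A]) (psi : homF hA e)
  (x y : A) : psi (x + y) = psi x + psi y.
Proof. exact: (raddfD psi). Qed.

Lemma homF_scale (A : comNzRingType) (hA : p \in [pchar A]) (psi : homF hA e)
  (s x : A) : psi (s ^+ q * x) = s * psi x.
Proof. exact: (linearZ_LR psi s (x : frob hA e)). Qed.

Definition lift_pure (a b : R) : tensor2 R :=
  \sum_(l <- L) tpure (phi (l.1 * a)) (t (l.2 * b)).

Lemma lift_pureDl a a' b : lift_pure (a + a') b = lift_pure a b + lift_pure a' b.
Proof.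
rewrite /lift_pure -big_split; apply: eq_bigr => l _.
by rewrite mulrDr homF_add tpureDl.
Qed.

Lemma lift_pureDr a b b' : lift_pure a (b + b') = lift_pure a b + lift_pure a b'.
Proof.
rewrite /lift_pure -big_split; apply: eq_bigr => l _.
by rewrite mulrDr tD tpureDr.
Qed.

Lemma lift_pureM x y a b :
  lift_pure (x ^+ q * a) (y ^+ q * b) = tpure x y * lift_pure a b.
Proof.
rewrite /lift_pure mulr_sumr; apply: eq_bigr => l _.
by rewrite !(mulrCA _ (_ ^+ _)) homF_scale tZ tpureM.
Qed.

Lemma frob_root_morphism : exists rt : {rmorphism k -> k}, forall c, rt c ^+ q = c.
Proof.
have /choice[rt rtE] : forall c : k, exists a, a ^+ q = c := perfect_frob e hk.
have inj (a b : k) : a ^+ q = b ^+ q -> a = b.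
  move=> eab; apply/eqP; rewrite -subr_eq0; have : (a - b) ^+ q == 0.
    by rewrite (frobB hpk) eab subrr.
  by rewrite expf_eq0 => /andP[].
have rtB : zmod_morphism rt by move=> a b; apply: inj; rewrite (frobB hpk) !rtE.
have rtM : monoid_morphism rt.
  by split=> [|a b]; apply: inj; rewrite ?exprMn !rtE ?expr1n.
pose rtm : {rmorphism k -> k} := HB.pack rt
  (GRing.isZmodMorphism.Build _ _ rt rtB) (GRing.isMonoidMorphism.Build _ _ rt rtM).
by exists rtm.
Qed.

Lemma tensor_lift : exists psi : homF (pchar_tensor2 hp) e,
  forall a b, psi (tpure a b) = lift_pure a b.
Proof.
have [rt rtE] := frob_root_morphism.
pose rho (c : k) : tensor2 R := tpure (rt c)%:A 1.
have rhoB : zmod_morphism rho.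
  move=> a b; apply/eqP; rewrite eq_sym subr_eq -tpureDl.
  by rewrite -scalerDl -rmorphD subrK.
have rhoM : monoid_morphism rho.
  split=> [|a b]; first by rewrite /rho rmorph1 scale1r.
  by rewrite /rho rmorphM -tpureM mulr1 -scalerAl mul1r scalerA.
pose rhom : {rmorphism k -> tensor2 R} := HB.pack rho
  (GRing.isZmodMorphism.Build _ _ rho rhoB) (GRing.isMonoidMorphism.Build _ _ rho rhoM).
pose g (a b : R) : restrict rhom := lift_pure a b.
have eA (c : k) (a : R) : c *: a = (rt c)%:A ^+ q * a.
  by rewrite -(rmorphXn (GRing.in_alg R)) /= rtE mulr_algl.
have bg : is_bilinear g.
  split=> [b c a a'|a c b b'].
    rewrite /g lift_pureDl eA; congr (_ + _).
    by have := lift_pureM (rt c)%:A 1 a b; rewrite expr1n mul1r.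
  rewrite /g lift_pureDr eA; congr (_ + _).
  by have := lift_pureM 1 (rt c)%:A a b; rewrite expr1n mul1r -tpureZ.
pose Psi (z : tensor2 R) : tensor2 R := tsum g (repr z).
have PsiE s : Psi (tclass s) = \sum_(u <- s) lift_pure u.1 u.2.
  exact: (tsum_repr bg).
have PsiP a b : Psi (tpure a b) = lift_pure a b by rewrite PsiE big_seq1.
have PsiD z w : Psi (z + w) = Psi z + Psi w.
  elim/tensor2W: z => s; elim/tensor2W: w => s'.
  by rewrite [_ + _]tadd_class !PsiE big_cat.
have Psi0 : Psi 0 = 0 by apply: (addrI (Psi 0)); rewrite -PsiD !addr0.
have PsiZ z w : Psi (z ^+ q * w) = z * Psi w.
  have hT := pchar_tensor2 hp.
  elim/tensor2_ind: z w => [w|x y|z z' IH IH' w].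
  - by rewrite (frob0 hT) !mul0r Psi0.
  - elim/tensor2_ind => [|a b|w w' IH IH']; first by rewrite mulr0 Psi0 mulr0.
      have -> : tpure x y ^+ q = tpure (x ^+ q) (y ^+ q).
        elim: (q) => [|m IH]; first by rewrite !expr0.
        by rewrite !exprS IH -tpureM.
      by rewrite -tpureM !PsiP lift_pureM.
    by rewrite !mulrDr !PsiD IH IH' mulrDr.
  - by rewrite (frobD hT) !mulrDl PsiD IH IH'.
pose Psi' : frob (pchar_tensor2 hp) e -> (tensor2 R)^o := Psi.
have Psi_lin : linear Psi' by move=> z w w'; rewrite /Psi' [LHS]PsiD PsiZ.
pose psi : homF (pchar_tensor2 hp) e := HB.pack Psi' (GRing.isLinear.Build _ _ _ _ Psi' Psi_lin).
by exists psi.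
Qed.

(** Applied to phi, the hypothesis on L makes the composite of mu with the lift
    of a (x) b depend on the product a b only: it turns the sum of the
    phi(l_1 a) t(l_2 b) into phi(delta^q a b), which is delta phi(a b). *)
Lemma tensor_lift_mu (delta : R) :
  (forall r, \sum_(l <- L) l.1 * t (l.2 * r) ^+ q = delta ^+ q * r) ->
  exists psi : homF (pchar_tensor2 hp) e,
    forall z, tmu (psi z) = delta * phi (tmu z).
Proof.
move=> hL; have [psi hpsi] := tensor_lift; exists psi.
elim/tensor2_ind => [|a b|z w IH IH'].
- by rewrite (raddf0 psi) tmu0 (raddf0 phi) mulr0.
- rewrite hpsi tmu_pure /lift_pure.
  have -> : tmu (\sum_(l <- L) tpure (phi (l.1 * a)) (t (l.2 * b)))
      = \sum_(l <- L) phi (l.1 * a) * t (l.2 * b).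
    elim: (L) => [|l s IH]; first by rewrite !big_nil tmu0.
    by rewrite !big_cons tmuD IH tmu_pure.
  rewrite -homF_scale mulrA [_ * a]mulrC -mulrA -hL mulr_sumr.
  have phi_sum (s : seq (R * R)) (G : R * R -> R) :
      phi (\sum_(l <- s) G l) = \sum_(l <- s) phi (G l).
    elim: s => [|l s IH]; first by rewrite !big_nil (raddf0 phi).
    by rewrite !big_cons homF_add IH.
  rewrite phi_sum; apply: eq_bigr => l _.
  by rewrite mulrC -homF_scale; congr (phi _); rewrite mulrCA mulrA mulrC mulrA.
- by rewrite (raddfD psi) !tmuD IH IH' homF_add mulrDr.
Qed.

End TensorLift.

(** * The Jacobian ideal and the test ideals *)

Lemma taylor_span (k : fieldType) (R : comAlgType k) n (v : 'I_n -> R)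
    (w : {mpoly R[n]}) :
  exists s : seq (R * {mpoly k[n]}), w = \sum_(u <- s) (u.1)%:MP * taylor v u.2.
Proof.
elim/mpoly_alg_ind: w => [c|i|a b [s ->] [s' ->]|a b [s ->] [s' ->]].
- by exists [:: (c, 1)]; rewrite big_seq1 (rmorph1 (taylor v)) mulr1.
- exists [:: (1, 'X_i); (- v i, 1)]; rewrite big_cons big_seq1 /= taylorX.
  by rewrite (rmorph1 (taylor v)) mulr1 mpolyC1 mul1r mpolyCN addrK.
- by exists (s ++ s'); rewrite big_cat.
- exists [seq (u.1 * u'.1, u.2 * u'.2) | u <- s, u' <- s'].
  rewrite big_allpairs_dep big_distrl; apply: eq_bigr => u _ /=.
  rewrite big_distrr; apply: eq_bigr => u' _ /=.
  by rewrite mpolyCM taylorM mulrACA.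
Qed.

Section Jacobian.
Variables (k : fieldType) (p : nat) (hpk : p \in [pchar k]).
Variables (hk : perfect_field k p) (R : comAlgType k) (X : eft_presentation R).
Variables (hred : reduced R) (d : nat) (hd : eft_equidimensional X d).
Local Notation hp := (pchar_base R hpk).
Local Notation n := (eft_n X).
Local Notation ev := (@eft_ev k R X).

(** The lift of delta phi is phi(delta . ) (x) t, premultiplied by the product of
    the (1 (x) x_j - x_j (x) 1)^(q-1) over the variables x_j that do not occur
    in the minor delta. *)
Lemma minor_lift e (phi : homF hp e)
    (g : 'I_(n - d) -> 'I_(eft_m X)) (h : 'I_(n - d) -> 'I_n) :
  exists psi : homF (pchar_tensor2 hp) e, forall z,
    tmu (psi z) = ev (\det (mxsub g h (jacobian_matrix X))) * phi (tmu z).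
Proof.
have [/injectiveP hinj|/injectivePn[j1 [j2 nej ej]]] := boolP (injectiveb h); last first.
  have -> : \det (mxsub g h (jacobian_matrix X)) = 0.
    rewrite -det_tr; apply: (determinant_alternate nej) => i.
    by rewrite !mxE ej.
  exists (\0 : homF (pchar_tensor2 hp) e) => z.
  by rewrite [ev 0]rmorph0 mul0r tmu0.
pose f i := eft_f (g i); have f0 i : ev (f i) = 0 := eft_ev_relation (g i).
have -> : mxsub g h (jacobian_matrix X) = \matrix_(i, j) (f i)^`M(h j).
  by apply/matrixP => i j; rewrite !mxE.
set delta := ev _.
have [t [tD tZ tE]] := trace_exists hpk hk hred hd e f0.
have [s es] := taylor_span (@eft_v k R X)
  (\prod_(j | j \notin codom h) 'X_j ^+ (p ^ e).-1).
pose L := [seq (delta * l.1, ev l.2) | l <- s].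
suff hL r : \sum_(l <- L) l.1 * t (l.2 * r) ^+ (p ^ e) = delta ^+ (p ^ e) * r.
  exact: (tensor_lift_mu hk phi tD tZ hL).
have [b [c [Sc erc]]] := eft_fraction hpk X e r.
have [u uc] := eft_unit Sc.
have er : r = u ^+ (p ^ e) * ev b.
  by rewrite -erc mulrCA -exprMn uc expr1n mulr1.
have := topcoef_jacobian hpk e f0 (taylor (@eft_v k R X) b) hinj.
rewrite es mulr_sumr mulr_suml taylor_at0 -/delta => eY.
have -> : delta ^+ (p ^ e) * r = delta * (u ^+ (p ^ e) *
    (delta ^+ (p ^ e).-1 * ev b)).
  by rewrite er -{1}(frob_pred hp e) exprS -mulrA [delta ^+ _ * _]mulrCA.
rewrite [X in _ * (_ * X)](esym eY) big_map {1}/topcoef (raddf_sum (mcoeff _)).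
rewrite !mulr_sumr; apply: eq_bigr => l _ /=.
rewrite er mulrCA tZ -(eft_evM l.2) exprMn tE -[in LHS]mulrA; congr (_ * _).
rewrite mulrCA; congr (_ * _); rewrite -topcoefZ; congr (topcoef _ _ _).
by rewrite !taylorM -!mulrA mulrCA.
Qed.

Lemma jac_diag2 e (x : R) (phi : homF hp e) : jac X d x ->
  cartier_deg (diag2 hp) e (x \*: phi : homF hp e).
Proof.
pose K : set R := [set x | exists psi : homF (pchar_tensor2 hp) e,
  forall z, tmu (psi z) = x * phi (tmu z)].
apply: (@ideal_gen_min _ _ K); last by move=> _ [g [h ->]]; apply: minor_lift.
split=> [|a b [psi hpsi] [psi' hpsi']|a b [psi hpsi]].
- by exists (\0 : homF (pchar_tensor2 hp) e) => z; rewrite mul0r tmu0.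
- exists (psi \+ psi' : homF (pchar_tensor2 hp) e) => z.
  by rewrite [LHS]tmuD hpsi hpsi' mulrDl.
- exists (tpure a 1 \*: psi : homF (pchar_tensor2 hp) e) => z.
  by rewrite [LHS]tmuM hpsi tmu_pure mulr1 mulrA.
Qed.

End Jacobian.

Section Weights.
Variables (A : comNzRingType) (p : nat) (hp : p \in [pchar A]).
Implicit Types (I J : set A).

Lemma ideal_mul_mem I J x y : I x -> J y -> ideal_mul I J (x * y).
Proof. by move=> Ix Jy; apply: ideal_gen_sub; exists x, y. Qed.

Lemma ideal_mul_ideal I J : is_ideal (ideal_mul I J).
Proof. exact: ideal_gen_ideal. Qed.

Lemma setT_ideal : is_ideal (setT : set A). Proof. by []. Qed.

Lemma ideal_exp_ideal I m : is_ideal (ideal_exp I m).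
Proof. by case: m => [|m]; [apply: setT_ideal | apply: ideal_mul_ideal]. Qed.

Lemma frob_preimage_ideal e I : is_ideal I -> is_ideal [set x | I (x ^+ (p ^ e))].
Proof.
move=> hI; split=> [|x y|a x] /=.
- by rewrite (frob0 hp); apply: ideal0.
- by rewrite (frobD hp); apply: idealD.
- by rewrite exprMn; apply: idealMl.
Qed.

Lemma ideal_expS_sub I m : ideal_exp I m.+1 `<=` ideal_exp I m.
Proof.
elim: m => [|m IH]; first exact: subsetT.
apply: ideal_gen_min; first exact: ideal_mul_ideal.
by move=> _ [x [y [Ix Iy ->]]]; apply: ideal_mul_mem => //; apply: IH.
Qed.

Lemma ideal_exp_anti I m m' : (m <= m')%N -> ideal_exp I m' `<=` ideal_exp I m.
Proof.
move=> /subnKC <-; elim: (m' - m)%N => [|j IH]; first by rewrite addn0.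
by rewrite addnS; apply: subset_trans IH; apply: ideal_expS_sub.
Qed.

Lemma ideal_exp_pow I x m : I x -> ideal_exp I m (x ^+ m).
Proof.
by move=> Ix; elim: m => [//|m IH]; rewrite exprS; apply: ideal_mul_mem.
Qed.

Lemma ideal_exp_mul I m m' x y : 
  ideal_exp I m x -> ideal_exp I m' y -> ideal_exp I (m + m') (x * y).
Proof.
move=> hx hy; elim: m x hx => [|m IH] x hx.
  by apply: idealMl => //; apply: ideal_exp_ideal.
apply: (@ideal_gen_min _ _ [set x | ideal_exp I (m + m').+1 (x * y)]) hx.
  have hI := ideal_exp_ideal I (m + m').+1.
  split=> [|u v hu hv|b u hu] /=.
  - by rewrite mul0r; apply: (ideal0 hI).
  - by rewrite mulrDl; apply: (idealD hI).
  - by rewrite -mulrA; apply: (idealMl _ hI).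
by move=> _ [u [v [Iu Iv ->]]] /=; rewrite -mulrA; apply: ideal_mul_mem => //; apply: IH.
Qed.

Lemma ideal_exp_frob I e m x :
  ideal_exp I m x -> ideal_exp I (p ^ e * m) (x ^+ (p ^ e)).
Proof.
elim: m x => [|m IH] x; first by rewrite muln0.
move=> hx; apply: (@ideal_gen_min _ _ [set x | ideal_exp I (p ^ e * m.+1) (x ^+ (p ^ e))]) hx.
  exact/frob_preimage_ideal/ideal_exp_ideal.
move=> _ [u [v [Iu Iv ->]]] /=; rewrite exprMn mulnS.
by apply: ideal_exp_mul; [apply: ideal_exp_pow | apply: IH].
Qed.

Variables (K : realType) (r : nat) (a : 'I_r -> set A) (t : 'I_r -> K).
Hypothesis t0 : forall i, 0 <= t i.

Lemma weight_ideal_ideal e : is_ideal (weight_ideal p a t e).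
Proof.
rewrite /weight_ideal; elim/big_ind: _ => [|I J _ _|i _].
- exact: setT_ideal.
- exact: ideal_mul_ideal.
- exact: ideal_exp_ideal.
Qed.

Lemma ceil_weight_add (s : K) e f : 0 <= s ->
  (`|Num.ceil (s * (p ^ (e + f) - 1)%N%:R)|
   <= p ^ f * `|Num.ceil (s * (p ^ e - 1)%N%:R)| + `|Num.ceil (s * (p ^ f - 1)%N%:R)|)%N.
Proof.
move=> s0; have p0 : (0 < p)%N := prime_gt0 (pcharf_prime hp).
have pe0 m : (0 < p ^ m)%N by rewrite expn_gt0 p0.
have absE m : (`|Num.ceil (s * (p ^ m - 1)%N%:R)|%N : int) = Num.ceil (s * (p ^ m - 1)%N%:R).
  by rewrite gez0_abs // -(ler_int K) (le_trans _ (ceil_ge _)) // mulr_ge0.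
rewrite -lez_nat PoszD PoszM !absE ceil_le_int.
have -> : (p ^ (e + f) - 1)%N = (p ^ f * (p ^ e - 1) + (p ^ f - 1))%N.
  by rewrite mulnBr muln1 addnBA // subnK ?leq_pmulr // -expnD addnC.
rewrite natrD natrM mulrDr rmorphD rmorphM /= lerD ?ceil_ge //.
by rewrite mulrCA ler_wpM2l // ceil_ge.
Qed.

(** The exponents ceil(t (p^e - 1)) are chosen so that composing maps of degrees
    e and f multiplies the corresponding weights correctly. *)
Lemma weight_ideal_mul e f x y : weight_ideal p a t e x -> weight_ideal p a t f y ->
  weight_ideal p a t (e + f) (x ^+ (p ^ f) * y).
Proof.
rewrite /weight_ideal => hx hy; move: x y hx hy.
apply: (big_ind3 (fun I J K : set A => forall x y, I x -> J y ->
  K (x ^+ (p ^ f) * y))) => // [I1 J1 K1 I2 J2 K2 h1 h2 x y hx hy|i _ x y hx hy].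
  have hK := ideal_mul_ideal K1 K2.
  have idx y' : is_ideal [set x' | ideal_mul K1 K2 (x' ^+ (p ^ f) * y')].
    split=> [|u v hu hv|b u hu] /=.
    - by rewrite (frob0 hp) mul0r; apply: (ideal0 hK).
    - by rewrite (frobD hp) mulrDl; apply: (idealD hK).
    - by rewrite exprMn -mulrA; apply: (idealMl _ hK).
  apply: (ideal_gen_min (idx y) _ hx) => _ [x1 [x2 [hx1 hx2 ->]]] /=.
  apply: (ideal_gen_min (ideal_quotient hK _) _ hy) => _ [y1 [y2 [hy1 hy2 ->]]] /=.
  by rewrite exprMn mulrACA; apply: ideal_mul_mem; [apply: h1 | apply: h2].
apply: ideal_exp_anti (ceil_weight_add e f (t0 i)) _ _.
by apply: ideal_exp_mul => //; apply: ideal_exp_frob.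
Qed.

(** The ideal generated by all phi(y c), with y in the weight ideal of the degree
    of phi, is compatible with the full Cartier algebra, and membership
    statements about it need only be checked on these generators. *)
Lemma full_compatible_below (c : A) : GRing.lreg c ->
  exists J', test_compatible a t (full_cartier hp) J' /\
    forall x J, is_ideal J ->
      (forall e (phi : homF hp e) y, weight_ideal p a t e y -> J (x * phi (y * c))) ->
      J' `<=` [set z | J (x * z)].
Proof.
move=> regc.
pose G : set A := [set z | exists e (phi : homF hp e) y,
  weight_ideal p a t e y /\ z = phi (y * c)].
exists (ideal_gen G); split; last first.
  move=> x J hJ hx; apply: ideal_gen_min; first exact: ideal_quotient.
  by move=> _ [e [phi [y [hy ->]]]]; apply: hx.
have hG : is_ideal (ideal_gen G) := @ideal_gen_ideal _ _.
split=> //.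
  exists c => //; apply: ideal_gen_sub.
  exists 0%N, (homF_of_scalar (1 : A) : homF hp 0), 1; split; last first.
    by rewrite /= /homF_of_scalar !mul1r.
  rewrite /weight_ideal; apply: (big_ind (fun I : set A => I 1)) => [//|I J I1 J1|i _].
    by rewrite -(mul1r 1); apply: ideal_mul_mem.
  by rewrite expn0 subnn mulr0 ceil0.
move=> e phi x y _ hx.
pose H : set A := [set y | forall e (phi : homF hp e) x,
  weight_ideal p a t e x -> ideal_gen G (phi (x * y))].
have hH : is_ideal H.
  split=> [f psi u hu|u v hu hv f psi w hw|b u hu f psi w hw].
  - by rewrite mulr0 (raddf0 psi); apply: (ideal0 hG).
  - by rewrite mulrDr (raddfD psi); apply: (idealD hG); [apply: hu | apply: hv].
  - rewrite mulrA; apply: hu; apply: (idealMr _ (weight_ideal_ideal f)) hw.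
suff sub : ideal_gen G `<=` H by move=> /sub Hy; apply: Hy hx.
apply: ideal_gen_min => //.
move=> _ [f [psi [w [hw ->]]]] f' psi' u hu; apply: ideal_gen_sub.
exists (f' + f)%N, (homF_comp psi' psi : homF hp (f' + f)), (u ^+ (p ^ f) * w).
split; first exact: weight_ideal_mul.
rewrite /= /homF_comp; congr (psi' _).
rewrite -mulrA; symmetry; exact: (linearZ_LR psi u (w * c : frob hp f)).
Qed.

End Weights.

Theorem theoremA (k : fieldType) (p : nat) (hp : p \in [pchar k])
    (hk : perfect_field k p) (R : comAlgType k) (X : eft_presentation R)
    (hred : reduced R) (heq : equidimensional R)
    (d : nat) (hd : eft_equidimensional X d) :
  (forall (e : nat) (x : R) (phi : homF (pchar_base R hp) e),
     jac X d x ->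
     cartier_deg (diag2 (pchar_base R hp)) e
       (x \*: phi : homF (pchar_base R hp) e)) /\
  (forall (K : realType) (r : nat) (a : 'I_r -> set R) (t : 'I_r -> K),
     (forall i, is_ideal (a i)) -> (forall i, has_regular (a i)) ->
     (forall i, 0 <= t i) ->
     ideal_mul (jac X d) (test_ideal a t (full_cartier (pchar_base R hp)))
       `<=` test_ideal a t (diag2 (pchar_base R hp))).
Proof.
split=> [e x phi|K r a t _ _ t0]; first exact: jac_diag2.
apply: ideal_gen_min.
  split=> [J [hJ _ _]|x y hx hy J cJ|b x hx J cJ]; first exact: ideal0.
    by case: (cJ) => hJ _ _; apply: (idealD hJ); [apply: hx | apply: hy].
  by case: (cJ) => hJ _ _; apply: (idealMl _ hJ); apply: hx.
move=> _ [x [y [jx ty ->]]] J [hJ [c Jc regc] cJ].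
have [J' [cJ' minJ']] := full_compatible_below (pchar_base R hp) a t0 regc.
apply: (minJ' x J hJ _ y (ty J' cJ')) => e phi w hw.
have hxphi := jac_diag2 hk hred hd phi jx.
exact: (cJ e _ w c hxphi hw Jc).
Qed.
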